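(* Let $q\in\mathbf C$ with $0<|q|<1$, $n\ge1$, $\mu\in\mathbf N$, and let $A=A_0+xA_1+\cdots+x^\mu A_\mu\in\mathrm{Mat}_n(\mathbf C[x])$ with $A_0,A_\mu\in\mathrm{GL}_n(\mathbf C)$, such that the $n$ eigenvalues $\rho_1,\ldots,\rho_n$ of $A_0$ are pairwise non congruent modulo $q^{\mathbf Z}$ and the $n$ eigenvalues $\sigma_1,\ldots,\sigma_n$ of $A_\mu$ are pairwise non congruent modulo $q^{\mathbf Z}$. Let $M=M_0^{-1}M_\infty$ be the connection matrix associated with $A$ as in the context. Then the system $\sigma_qX=AX$ is reducible if and only if some matrix $M'$ obtained from $M$ by a permutation of its rows and a permutation of its columns is block triangular.
   Context: Notation: $\sigma_qf(x):=f(qx)$ (entrywise on matrices); $F[A]:=(\sigma_qF)AF^{-1}$; $\mathbf C\{x\}$, $\mathbf C\{1/x\}$ are the rings of convergent power series in $x$, $1/x$; $a,b\in\mathbf C^*$ are congruent modulo $q^{\mathbf Z}$ if $a/b\in q^{\mathbf Z}$. Connection matrix: put $R:=\mathrm{Diag}(\rho_1,\ldots,\rho_n)$, $S:=\mathrm{Diag}(\sigma_1,\ldots,\sigma_n)$; choose $C,D\in\mathrm{GL}_n(\mathbf C)$ with $A_0=CRC^{-1}$, $A_\mu=DSD^{-1}$. There are unique $M_0\in\mathrm{GL}_n(\mathbf C\{x\})$, $M_\infty\in\mathrm{GL}_n(\mathbf C\{1/x\})$ with $M_0(0)=C$, $M_0[R]=A$, $M_\infty(\infty)=D$, $M_\infty[Sx^\mu]=A$;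 they extend meromorphically to $\mathbf C$, resp. $\mathbf P^1(\mathbf C)\setminus\{0\}$, and $M:=M_0^{-1}M_\infty$ is holomorphic on $\mathbf C^*$, with $\sigma_qM=RM(Sx^\mu)^{-1}$. It is well defined up to $M\mapsto\Gamma^{-1}M\Delta$ with $\Gamma,\Delta$ invertible diagonal. The system $\sigma_qX=AX$ is reducible if there is $F\in\mathrm{GL}_n(\mathbf C(x))$ such that $F[A]$ is block triangular with square diagonal blocks of sizes $r$ and $n-r$ for some $0<r<n$. ''Block triangular'' for $M'$ is understood likewise: square diagonal blocks of sizes $r$, $n-r$ with $0<r<n$, one off-diagonal block being identically zero. The row permutation and the column permutation may be different. *)

(* Defs.v *)
From HB Require Import structures.
From mathcomp Require Import all_boot all_order all_algebra fraction generic_quotient.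
From mathcomp Require Import complex.
From mathcomp Require Import all_classical all_reals all_analysis.

Set Implicit Arguments.
Unset Strict Implicit.
Unset Printing Implicit Defensive.

Import Order.TTheory GRing.Theory Num.Theory.
Import numFieldNormedType.Exports.
Local Open Scope classical_set_scope.
Local Open Scope ring_scope.

(* Matrix-valued functions of a complex variable are total functions
   [C -> 'M[C]_n]; a meromorphic one takes arbitrary values at its poles, so
   identities between meromorphic functions are only asserted near each point,
   the point itself excluded (filter [z^']). *)

Section Germs.
Variable C : numFieldType.

(* The germ of [f] at 0 is in C{x}. *)
Definition cvg_pseries (f : C -> C) : Prop :=
  exists c : nat -> C,
    \forall x \near (0 : C), series (fun k => c k * x ^+ k) @ \oo --> f x.

(* Laurent expansion at [z] with finite principal part. *)
Definition meromorphic_at (f : C -> C) (z : C) : Prop :=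
  exists (m : nat) (g : C -> C),
    cvg_pseries g /\ \forall h \near (0 : C)^', h ^+ m * f (z + h) = g h.

Definition mx_pseries n (F : C -> 'M[C]_n) : Prop :=
  forall i j, cvg_pseries (fun x => F x i j).

(* The germ of [F] at 0 is in GL_n(C{x}). *)
Definition GL_pseries n (F : C -> 'M[C]_n) : Prop :=
  mx_pseries F /\
  exists2 G : C -> 'M[C]_n, mx_pseries G & \forall x \near (0 : C), F x *m G x = 1%:M.

Definition mx_meromorphic_at n (F : C -> 'M[C]_n) (z : C) : Prop :=
  forall i j, meromorphic_at (fun x => F x i j) z.

Definition mx_holomorphic_on n (D : set C) (F : C -> 'M[C]_n) : Prop :=
  forall z, D z -> forall i j, derivable (fun x => F x i j) z 1.

End Germs.

Lemma frac_reprE (R : idomainType) (f : {fraction R}) :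
  f = tofrac (frac (repr f)).1 / tofrac (frac (repr f)).2.
Proof.
rewrite -[f in LHS]reprK; move: (repr f) => x.
have x0 : tofrac (frac x).2 != 0 by rewrite tofrac_eq0 denom_ratioP.
apply: (canRL (mulfK x0)); rewrite -[LHS]/(FracField.mul _ _) !piE.
apply/eqmodP; rewrite /= FracField.equivfE /FracField.mulf.
by rewrite !numden_Ratio ?mulf_neq0 ?denom_ratioP ?oner_neq0 // !mulr1 mulrC.
Qed.

Section Connection.
Variable C : numFieldType.
Implicit Types (q : C) (n mu : nat).

Definition mx_coef n (A : 'M[{poly C}]_n) (k : nat) : 'M[C]_n :=
  map_mx (fun p : {poly C} => p`_k) A.

Definition mx_eval n (A : 'M[{poly C}]_n) (x : C) : 'M[C]_n :=
  map_mx (fun p : {poly C} => p.[x]) A.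

Definition congruent_mod_qZ q (a b : C) : Prop := exists k : int, a / b = q ^ k.

(* [s] lists the eigenvalues of [B] with multiplicity, and they are pairwise
   non congruent modulo q^Z. *)
Definition noncongruent_spectrum q n (B : 'M[C]_n) (s : 'rV[C]_n) : Prop :=
  char_poly B = \prod_(i < n) ('X - (s 0 i)%:P) /\
  forall i j, i != j -> ~ congruent_mod_qZ q (s 0 i) (s 0 j).

(* F[B] at [x]. *)
Definition gauge_fun q n (F B : C -> 'M[C]_n) (x : C) : 'M[C]_n :=
  F (q * x) *m B x *m invmx (F x).

Definition solution_at_0 q n (A : 'M[{poly C}]_n) (rho : 'rV[C]_n)
    (P : 'M[C]_n) (M0 : C -> 'M[C]_n) : Prop :=
  [/\ GL_pseries M0,
      M0 0 = P,
      \forall x \near (0 : C),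
        gauge_fun q M0 (fun=> diag_mx rho) x = mx_eval A x &
      forall z, mx_meromorphic_at M0 z].

(* Neighbourhoods of infinity are read in the coordinate u = 1/x; [U] is the
   germ of M_infinity in C{u}, so that U 0 is the value at infinity. *)
Definition solution_at_infty q n mu (A : 'M[{poly C}]_n) (sigma : 'rV[C]_n)
    (Q : 'M[C]_n) (Minf : C -> 'M[C]_n) : Prop :=
  [/\ exists U : C -> 'M[C]_n,
        [/\ GL_pseries U,
            U 0 = Q &
            \forall u \near (0 : C)^', Minf u^-1 = U u],
      \forall u \near (0 : C)^',
        gauge_fun q Minf (fun x => x ^+ mu *: diag_mx sigma) u^-1
          = mx_eval A u^-1 &
      forall z, z != 0 -> mx_meromorphic_at Minf z].

Definition connection_matrix q n mu (A : 'M[{poly C}]_n) (rho sigma : 'rV[C]_n)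
    (M : C -> 'M[C]_n) : Prop :=
  exists (P Q : 'M[C]_n) (M0 Minf : C -> 'M[C]_n),
    [/\ P \in unitmx /\ mx_coef A 0 = P *m diag_mx rho *m invmx P,
        Q \in unitmx /\ mx_coef A mu = Q *m diag_mx sigma *m invmx Q,
        solution_at_0 q A rho P M0,
        solution_at_infty q mu A sigma Q Minf &
        mx_holomorphic_on [set z | z != 0] M /\
        forall z, z != 0 ->
          \forall x \near z^', M x = invmx (M0 x) *m Minf x].

(* [Z i j] reads "the (i, j) entry is identically zero". *)
Definition block_triangular n (Z : 'I_n -> 'I_n -> Prop) : Prop :=
  exists2 r : nat, (0 < r < n)%N &
    (forall i j : 'I_n, (r <= i)%N -> (j < r)%N -> Z i j) \/
    (forall i j : 'I_n, (i < r)%N -> (r <= j)%N -> Z i j).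

Local Notation Cx := {fraction {poly C}}.

(* f(x) |-> f(qx) on C(x), through a chosen numerator and denominator of f;
   the choice is immaterial when q != 0 (sigma_frac_div below). *)
Definition sigma_frac q (f : Cx) : Cx :=
  let shift (p : {poly C}) := tofrac (p \Po (q *: 'X)) in
  shift (frac (repr f)).1 / shift (frac (repr f)).2.

Definition gauge_frac q n (F B : 'M[Cx]_n) : 'M[Cx]_n :=
  map_mx (sigma_frac q) F *m B *m invmx F.

Definition reducible q n (A : 'M[{poly C}]_n) : Prop :=
  exists2 F : 'M[Cx]_n, F \in unitmx &
    block_triangular
      (fun i j => gauge_frac q F (map_mx (@tofrac {poly C}) A) i j = 0).

Lemma sigma_frac_div q (a b : {poly C}) : q != 0 -> b != 0 ->
  sigma_frac q (tofrac a / tofrac b)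
    = tofrac (a \Po (q *: 'X)) / tofrac (b \Po (q *: 'X)).
Proof.
move=> q0 b0; rewrite /sigma_frac.
have d0 := denom_ratioP (repr (tofrac a / tofrac b)).
have := frac_reprE (tofrac a / tofrac b).
move: (frac (repr (tofrac a / tofrac b))) d0 => -[u v] /= v0 /eqP.
rewrite eqr_div ?tofrac_eq0 // -!tofracM tofrac_eq => /eqP E.
have shift0 (p : {poly C}) : p != 0 -> tofrac (p \Po (q *: 'X)) != 0.
  move=> p0; rewrite tofrac_eq0 -size_poly_eq0 size_comp_poly2 ?size_poly_eq0 //.
  by rewrite size_scale // size_polyX.
apply/eqP; rewrite eqr_div ?shift0 // -!tofracM -!comp_polyM.
by rewrite E.
Qed.

End Connection.

(* Main.v *)
Require Import Defs.
From mathcomp Require Import all_boot all_order perm all_algebra fraction.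
From mathcomp Require Import complex.
From mathcomp Require Import all_classical all_reals all_analysis.
From mathcomp Require Import ring.

(* Reducibility means that some proper nonzero subspace of row vectors over C(x),
   spanned by the rows of a matrix P, is stable: P(qx) A(x) = b(x) P(x).

   If so, N = P M0 satisfies N(qx) R = b N near 0. A function meromorphic at 0 with
   f(qx) = c f(x) vanishes unless c is a power of q; as the eigenvalues are non
   congruent, the row space of N is a coordinate subspace, and so is that of
   P Minf, for the same reason at infinity. As (P M0) M = P Minf, the matrix M
   then has an m x (n - m) block of zeros.

   Conversely, such a block makes m rows of M0^-1 and m rows of Minf^-1 span the
   same space. Its basis normalized by an identity minor is meromorphic at every
   point of the Riemann sphere, hence rational, and the equation of M0 near 0
   shows that it is stable.

   That a function meromorphic on the sphere is rational is obtained without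
   integration: after removing finitely many poles it is the maximum principle
   for power series, combined with the compactness of discs. *)

Set Implicit Arguments.
Unset Strict Implicit.
Unset Printing Implicit Defensive.

Import Order.TTheory GRing.Theory Num.Theory.
Import numFieldNormedType.Exports.
Local Open Scope classical_set_scope.
Local Open Scope ring_scope.

(** * Power series *)

(** Two obstacles shape the proof. An element of C(x) cannot be evaluated at a point, so
    reducibility is first restated with polynomial matrices and an explicit common denominator
    ([invariant_lattice]); algebra stays on one side of that statement and analysis on the other. A
    meromorphic function has arbitrary values at its poles, so identities live on punctured
    neighbourhoods. There a meromorphic germ either vanishes identically or has no zero, and the
    connectedness of segments carries either property from point to point. Actual values are
    recovered only from limits.

    The row and column permutations are kept out of the analysis: a zero block is given by two
    injections [a] and [b] with the same source ['I_m], its rows being the image of [a] and its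
    columns the complement of the image of [b]. The same [m] occurs twice because one
    [m]-dimensional subspace is read in the basis at 0 and in the basis at infinity.

    Power series are handled with crude geometric bounds on a small disc; the exact radius of
    convergence never matters. *)

Section PowerSeries.
Variable C : numFieldType.
(* Archimedean property of C: a [numFieldType] need not have it. *)
Hypothesis cvg_half : (fun n => (2^-1 : C) ^+ n) @ \oo --> (0 : C).
Implicit Types (c d : nat -> C) (f g : C -> C) (x y : C).

Definition psum c x : nat -> C := series (fun k => c k * x ^+ k).

Definition psum_to c f := \forall x \near (0 : C), psum c x @ \oo --> f x.

Lemma psumE c x n : psum c x n = \sum_(i < n) c i * x ^+ i.
Proof. by rewrite /psum /series /= big_mkord. Qed.

Lemma cvg_norm_le (u : nat -> C) (l B : C) :
  u @ \oo --> l -> (forall n, `|u n| <= B) -> `|l| <= B.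
Proof.
move=> ul uB; have B0 : 0 <= B by exact: le_trans (normr_ge0 _) (uB 0%N).
rewrite real_leNgt ?ger0_real //; apply/negP => Bl.
have e0 : 0 < `|l| - B by rewrite subr_gt0.
move/cvgrPdist_lt: ul => /(_ _ e0) [N _ /(_ N (leqnn N))] /= H.
have := le_lt_trans (lerB_dist _ _) H.
by rewrite ltrD2l ltrN2 => /lt_le_trans /(_ (uB N)); rewrite ltxx.
Qed.

(** The terms of a series convergent at one nonzero [x] tend to 0, hence are bounded; [r] is the
    inverse of [|x|]. All later estimates start from this geometric domination. *)
Lemma psum_bound c f : psum_to c f ->
  exists K r : C, [/\ 0 < K, 0 < r & forall k, `|c k| <= K * r ^+ k].
Proof.
move=> cf; have : \forall x \near (0 : C)^', psum c x @ \oo --> f x /\ x != 0.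
  near=> x; split; last by near: x; exact: nbhs_dnbhs_neq.
  by near: x; apply: nbhs_dnbhs.
case/filter_ex => x [cfx x0].
have : (fun k => c k * x ^+ k) @ \oo --> (0 : C).
  apply: cvg_series_cvg_0; by apply/cvg_ex; exists (f x).
move=> /cvgrPdist_lt /(_ 1 ltr01) [N _ HN].
pose K := 1 + \sum_(i < N) `|c i * x ^+ i|.
have K1 : 1 <= K by rewrite lerDl sumr_ge0.
exists K, `|x|^-1; split.
- exact: lt_le_trans K1.
- by rewrite invr_gt0 normr_gt0.
move=> k; rewrite exprVn ler_pdivlMr ?exprn_gt0 ?normr_gt0 //.
rewrite -normrX -normrM; have [kN|Nk] := ltnP k N.
  rewrite /K (bigD1 (Ordinal kN)) //= addrCA lerDl addr_ge0 ?sumr_ge0 //.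
apply: le_trans K1; have := HN k Nk; rewrite /= sub0r normrN; exact: ltW.
Unshelve. all: by end_near. Qed.

Lemma psum_at0 c f : psum_to c f -> f 0 = c 0%N.
Proof.
move/nbhs_singleton => cf; apply: (cvg_unique _ cf).
  exact: norm_hausdorff.
apply: cvg_near_cst; exists 1%N => // -[//|n] _ /=.
by rewrite psumE big_ord_recl expr0 mulr1 big1 ?addr0 // => i _; rewrite expr0n /= mulr0.
Qed.


Lemma sum_half n : \sum_(i < n) (2^-1 : C) ^+ i <= 2.
Proof.
suff -> : \sum_(i < n) (2^-1 : C) ^+ i = 2 - 2 * 2^-1 ^+ n.
  by rewrite lerBlDr lerDl mulr_ge0 ?exprn_ge0 ?invr_ge0.
elim: n => [|n IH]; first by rewrite big_ord0 expr0 mulr1 subrr.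
by rewrite big_ord_recr /= IH exprS; field.
Qed.

(** This is [k + 1 <= 2 ^ k]. It absorbs the number of terms in a Cauchy product coefficient, or in
    the cofactor of [x - y] in a difference of powers, at the price of shrinking discs to radius
    [1 / (4 r)]. *)
Lemma mulrn_quarter_exp k : (4^-1 : C) ^+ k *+ k.+1 <= 2^-1 ^+ k.
Proof.
elim: k => [|k IH]; first by rewrite !expr0 mulr1n.
rewrite exprS -mulrnAr [leRHS]exprS.
rewrite {1}(_ : (4^-1 : C) = 2^-1 * 2^-1); last by field.
rewrite -mulrA ler_pM2l ?invr_gt0 //; rewrite ler_pdivrMl //.
apply: (@le_trans _ _ ((4^-1 : C) ^+ k *+ k.+1 *+ 2)).
  rewrite -mulrnA; apply: ler_wpMn2l; first by rewrite exprn_ge0 ?invr_ge0.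
  by rewrite muln2 -addnn addSn addnS !ltnS leq_addr.
by rewrite mulr_natl lerMn2r IH orbT.
Qed.

Lemma subX_le (x y D : C) k : `|x| <= D -> `|y| <= D ->
  `|x ^+ k.+1 - y ^+ k.+1| <= `|x - y| * (D ^+ k *+ k.+1).
Proof.
move=> xD yD; rewrite subrXX normrM ler_wpM2l //.
apply: (le_trans (ler_norm_sum _ _ _)).
rewrite -[k.+1 in leRHS]card_ord -sumr_const; apply: ler_sum => i _.
rewrite normrM !normrX -[in leRHS](subnK (leq_ord i)) exprD.
by apply: ler_pM; rewrite ?exprn_ge0 //; apply: lerXn2r; rewrite ?nnegrE // (le_trans _ xD).
Qed.

(** The estimate is made term by term on partial sums and survives the limit. It is the source of
    the continuity of a sum at all points near 0, not only at 0. *)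
Lemma psum_lipschitz c f : psum_to c f ->
  exists L e : C, [/\ 0 < L, 0 < e &
    forall x y, `|x| < e -> `|y| < e -> `|f x - f y| <= L * `|x - y|].
Proof.
move=> cf; have [K [r [K0 r0 Kr]]] := psum_bound cf.
have /nbhs_normP[e1 /= e10 He] := cf.
have r40 : 0 < (4 * r)^-1 by rewrite invr_gt0 mulr_gt0.
(* The order of [C] is partial; the two radii are comparable because positive elements are real. The
   bound [1 / (4 r)] makes the successive terms [K r 2^-i] Lipschitz, and these constants sum to at
   most [2 K r]. *)
pose e := if e1 <= (4 * r)^-1 then e1 else (4 * r)^-1.
have e0 : 0 < e by rewrite /e; case: ifP.
have [ee1 er] : e <= e1 /\ e <= (4 * r)^-1.
  rewrite /e; case: (real_leP (gtr0_real e10) (gtr0_real r40)) => // ?; split => //; exact: ltW.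
exists (2 * (K * r)), e; split; rewrite ?mulr_gt0 // => x y xe ye.
have H z : `|z| < e -> psum c z @ \oo --> f z.
  by move=> ze; apply: He; rewrite /= sub0r normrN (lt_le_trans ze).
apply: (cvg_norm_le (cvgB (H x xe) (H y ye))) => n.
rewrite /= -/(_ - _) [X in `|X|](_ : _ = \sum_(i < n) c i * (x ^+ i - y ^+ i)); last first.
  by rewrite -[LHS]/(psum c x n - psum c y n) !psumE -sumrB; apply: eq_bigr => i _; rewrite mulrBr.
case: n => [|n]; first by rewrite big_ord0 normr0; do !apply: mulr_ge0 => //; exact: ltW.
rewrite big_ord_recl !expr0 subrr mulr0 add0r.
apply: (le_trans (ler_norm_sum _ _ _)).
apply: (@le_trans _ _ (\sum_(i < n) (K * r * `|x - y|) * 2^-1 ^+ i)); last first.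
  rewrite -mulr_sumr [leRHS](_ : _ = K * r * `|x - y| * 2); last by ring.
  by rewrite ler_wpM2l ?sum_half //; do !apply: mulr_ge0 => //; exact: ltW.
apply: ler_sum => i _; rewrite normrM.
have -> : K * r * `|x - y| * 2^-1 ^+ i = (K * r ^+ i.+1) * (`|x - y| * ((r^-1 * 2^-1) ^+ i)).
  rewrite exprMn exprS (exprVn r).
  have : r ^+ i != 0 by rewrite expf_neq0 ?gt_eqF.
  by move: (r ^+ i) (2^-1 ^+ i) => s t s0; field.
rewrite lift0; apply: ler_pM => //.
apply: (le_trans (@subX_le _ _ (4 * r)^-1 _ _ _)).
- exact: le_trans (ltW xe) er.
- exact: le_trans (ltW ye) er.
rewrite ler_wpM2l // invfM [4^-1 * _]mulrC !exprMn -mulrnAr ler_wpM2l //.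
  by rewrite exprn_ge0 // invr_ge0 ltW.
exact: mulrn_quarter_exp.
Qed.

Definition cauchy_prod c d n := \sum_(i < n.+1) c i * d (n - i)%N.

(** The difference consists of the coefficients of degree [n] to [2n - 1] in the product of the two
    truncations, so it is at most [2 K K' 2^-n]. Convergence of the two series is not presupposed,
    which allows the use for an inverse series whose convergence is still to be shown. *)
Lemma cauchy_prod_err c d (K K' r : C) x :
    (forall k, `|c k| <= K * r ^+ k) -> (forall k, `|d k| <= K' * r ^+ k) ->
    0 < r -> `|x| * r <= 4^-1 ->
  (fun n => psum c x n * psum d x n - psum (cauchy_prod c d) x n) @ \oo --> (0 : C).
Proof.
move=> cK dK r0 xr.
have K0 : 0 <= K by have := le_trans (normr_ge0 _) (cK 0%N); rewrite expr0 mulr1.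
have K'0 : 0 <= K' by have := le_trans (normr_ge0 _) (dK 0%N); rewrite expr0 mulr1.
apply/cvgr0Pnorm_lt => e e0.
have : (fun n => K * K' * 2 * (2^-1 : C) ^+ n) @ \oo --> (0 : C).
  by rewrite -(mulr0 (K * K' * 2)); apply: cvgMl_tmp.
move/cvgr0Pnorm_lt => /(_ e e0); apply: filterS => n /=; apply: le_lt_trans.
rewrite [leRHS]ger0_norm ?mulr_ge0 ?exprn_ge0 ?invr_ge0 //.
pose p := \poly_(i < n) c i; pose p' := \poly_(i < n) d i.
have sp : (size p <= n)%N by exact: size_poly.
have sp' : (size p' <= n)%N by exact: size_poly.
have pp'E k : (p * p')`_k = \sum_(i < k.+1) p`_i * p'`_(k - i) by rewrite coefM.
have -> : psum c x n * psum d x n = \sum_(i < n + n) (p * p')`_i * x ^+ i.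
  rewrite -horner_coef_wide; last first.
    by rewrite (leq_trans (size_polyMleq _ _)) // (leq_trans (leq_pred _)) // leq_add.
  by rewrite hornerM !horner_poly !psumE.
rewrite big_split_ord /= psumE.
rewrite [X in X + _ - _](_ : _ = \sum_(i < n) cauchy_prod c d i * x ^+ i); last first.
  apply: eq_bigr => i _; congr (_ * _); rewrite pp'E; apply: eq_bigr => j _.
  rewrite !coef_poly (leq_ltn_trans (leq_ord j) (ltn_ord i)).
  by rewrite (leq_ltn_trans (leq_subr _ _) (ltn_ord i)).
rewrite addrAC subrr add0r.
apply: (le_trans (ler_norm_sum _ _ _)).
have pK k : `|p`_k| <= K * r ^+ k.
  by rewrite coef_poly; case: ifP => // _; rewrite normr0 mulr_ge0 // exprn_ge0 // ltW.
have p'K k : `|p'`_k| <= K' * r ^+ k.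
  by rewrite coef_poly; case: ifP => // _; rewrite normr0 mulr_ge0 // exprn_ge0 // ltW.
apply: (@le_trans _ _ (\sum_(i < n) (K * K' * 2^-1 ^+ n) * 2^-1 ^+ i)); last first.
  by rewrite -mulr_sumr -!mulrA [2 * _]mulrC; do 3!(apply: ler_wpM2l; rewrite ?exprn_ge0 ?invr_ge0 //); exact: sum_half.
apply: ler_sum => i _; rewrite -mulrA -exprD normrM normrX; set k := (n + i)%N.
apply: (@le_trans _ _ ((K * K' * r ^+ k *+ k.+1) * `|x| ^+ k)).
  rewrite ler_wpM2r ?exprn_ge0 // pp'E (le_trans (ler_norm_sum _ _ _)) //.
  rewrite -[k.+1 in leRHS]card_ord -sumr_const; apply: ler_sum => j _.
  rewrite normrM -[in leRHS](subnKC (leq_ord j)) exprD.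
  by rewrite mulrACA; apply: ler_pM.
rewrite [leLHS](_ : _ = K * K' * ((`|x| * r) ^+ k *+ k.+1)); last first.
  by rewrite -(mulr_natr (K * K' * _)) -(mulr_natr (_ ^+ k)) exprMn; ring.
apply: ler_wpM2l; first exact: mulr_ge0.
apply: le_trans (mulrn_quarter_exp k).
rewrite lerMn2r /=.
by apply: lerXn2r; rewrite ?nnegrE ?mulr_ge0 ?invr_ge0 // ltW.
Qed.


Lemma psum_to_mul c d f g : psum_to c f -> psum_to d g ->
  psum_to (cauchy_prod c d) (f \* g).
Proof.
move=> cf dg; have [K [r [K0 r0 Kr]]] := psum_bound cf.
have [K' [r' [K'0 r'0 Kr']]] := psum_bound dg.
have R0 : 0 < r + r' by rewrite addr_gt0.
have small : \forall x \near (0 : C), `|x| * (r + r') <= 4^-1.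
  apply/nbhs_normP; exists (4^-1 / (r + r')) => /=; first by rewrite divr_gt0 ?invr_gt0.
  by move=> x /=; rewrite sub0r normrN ltr_pdivlMr // => /ltW.
move: cf dg small; apply: filterS3 => x cfx dgx xr.
have := @cauchy_prod_err c d K K' (r + r') x _ _ R0 xr.
move=> /(_ _ _)/wrap[].
  by move=> k; apply: (le_trans (Kr k)); rewrite ler_wpM2l ?(ltW K0) //; apply: lerXn2r; rewrite ?nnegrE ?(ltW r0) ?(ltW R0) // lerDl ltW.
  by move=> k; apply: (le_trans (Kr' k)); rewrite ler_wpM2l ?(ltW K'0) //; apply: lerXn2r; rewrite ?nnegrE ?(ltW r'0) ?(ltW R0) // lerDr ltW.
move=> err; rewrite -[(f \* g) x]/(f x * g x) -[f x * g x]subr0.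
rewrite (_ : psum (cauchy_prod c d) x = (psum c x \* psum d x) -
   (fun n => psum c x n * psum d x n - psum (cauchy_prod c d) x n)); last first.
  by apply/funext => n; rewrite !fctE opprB addrC subrK.
by apply: cvgB => //; exact: cvgM.
Qed.

Lemma psum_to_continuous c f : psum_to c f ->
  \forall x \near (0 : C), f y @[y --> x] --> f x.
Proof.
move=> /psum_lipschitz [L [e [L0 e0 fL]]].
apply/nbhs_normP; exists e => //= x /=; rewrite sub0r normrN => xe.
apply/(@cvgrPdist_lt C C C (nbhs x) _ f (f x)) => eps eps0; apply/nbhs_normP.
have d0 : 0 < e - `|x| by rewrite subr_gt0.
pose d := if e - `|x| <= eps / L then e - `|x| else eps / L.
have dd : 0 < d by rewrite /d; case: ifP => // _; rewrite divr_gt0.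
have [d1 d2] : d <= e - `|x| /\ d <= eps / L.
  rewrite /d; case: (real_leP (gtr0_real d0) (gtr0_real (divr_gt0 eps0 L0))) => // ?; split => //; exact: ltW.
exists d => //= y /= xy; apply: (@le_lt_trans _ _ (L * `|x - y|)).
  apply: fL => //; rewrite -[y](subKr x) (le_lt_trans (ler_normB _ _)) //.
  by rewrite -ltrBrDl (lt_le_trans xy).
by rewrite mulrC -ltr_pdivlMr // (lt_le_trans xy).
Qed.

Lemma psum_continuous0 c f : psum_to c f -> f @ (0 : C) --> f 0.
Proof. by move/psum_to_continuous => /nbhs_singleton. Qed.

Section Inverse.
Variable c : nat -> C.

(** Course-of-values recursion: each coefficient of the inverse series depends on all earlier ones,
    so the whole list is carried along. *)
Fixpoint inv_seq n : seq C :=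
  if n is m.+1 then
    let s := inv_seq m in
    rcons s ((c 0%N)^-1 * ((m == 0%N)%:R - \sum_(i < m) c (m - i)%N * s`_i))
  else [::].

Definition inv_coef n := (inv_seq n.+1)`_n.

Lemma size_inv_seq n : size (inv_seq n) = n.
Proof. by elim: n => //= n IH; rewrite size_rcons IH. Qed.

Lemma nth_inv_seq n i : (i < n)%N -> (inv_seq n)`_i = inv_coef i.
Proof.
elim: n => // n IH; rewrite ltnS leq_eqVlt => /orP[/eqP -> //|lt_in].
by rewrite /= nth_rcons size_inv_seq lt_in IH.
Qed.

Lemma inv_coefE n : inv_coef n =
  (c 0%N)^-1 * ((n == 0%N)%:R - \sum_(i < n) c (n - i)%N * inv_coef i).
Proof.
rewrite {1}/inv_coef /= nth_rcons size_inv_seq ltnn eqxx; congr (_ * (_ - _)).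
by apply: eq_bigr => i _; rewrite nth_inv_seq.
Qed.

Lemma cauchy_prod_inv : c 0%N != 0 ->
  forall n, cauchy_prod c inv_coef n = (n == 0%N)%:R.
Proof.
move=> c0 n; rewrite /cauchy_prod (reindex_inj rev_ord_inj) /=.
rewrite (eq_bigr (fun i : 'I_n.+1 => c (n - i)%N * inv_coef i)); last first.
  by move=> i _; rewrite /= subSS subKn // -ltnS.
rewrite big_ord_recr /= subnn [inv_coef n]inv_coefE mulVKf //.
by rewrite addrC subrK.
Qed.

(** With [kap = K / |c 0|], the recursion is dominated by [kap] times a geometric sum of ratio
    [1 + kap], which telescopes to [(1 + kap) ^ k - 1]. This is why the rate [r] is multiplied by
    [1 + kap]. *)
Lemma inv_coef_bound K r : c 0%N != 0 -> 0 < K -> 0 < r ->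
    (forall k, `|c k| <= K * r ^+ k) ->
  forall k, `|inv_coef k| <= `|c 0%N|^-1 * (r * (1 + K / `|c 0%N|)) ^+ k.
Proof.
move=> c0 K0 r0 Kr; have a0 : 0 < `|c 0%N| by rewrite normr_gt0.
set kap := K / `|c 0%N|; have kap0 : 0 < kap by rewrite divr_gt0.
elim/ltn_ind => k IH; rewrite inv_coefE normrM normfV ler_pM2l ?invr_gt0 //.
case: k IH => [|k] IH; first by rewrite big_ord0 subr0 normr1 expr0.
rewrite sub0r normrN (le_trans (ler_norm_sum _ _ _)) //.
apply: (@le_trans _ _ (\sum_(i < k.+1) r ^+ k.+1 * (kap * (1 + kap) ^+ i))).
  apply: ler_sum => i _; rewrite normrM.
  apply: le_trans (ler_pM _ _ (Kr _) (IH _ (ltn_ord i))) _ => //.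
  rewrite exprMn [leRHS](_ : _ = K * r ^+ (k.+1 - i) * (`|c 0%N|^-1 * (r ^+ i * (1 + kap) ^+ i))) //.
  have -> : r ^+ k.+1 = r ^+ (k.+1 - i) * r ^+ i by rewrite -exprD subnK // ltnW.
  by rewrite /kap; ring.
rewrite -mulr_sumr -mulr_sumr exprMn ler_pM2l ?exprn_gt0 //.
have := subrX1 (1 + kap) k.+1; rewrite [1 + kap - 1]addrC addKr => <-.
by rewrite gerBl.
Qed.

End Inverse.

(** The partial sums for [c] and [inv_coef c] have a product tending to 1, and those for [c] tend to
    the nonzero [f x]; dividing gives the convergence of the inverse series and its sum at once. *)
Lemma psum_to_inv c f : psum_to c f -> f 0 != 0 ->
  psum_to (inv_coef c) (fun x => (f x)^-1).
Proof.
move=> cf f0; have c0 : c 0%N != 0 by rewrite -(psum_at0 cf).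
have [K [r [K0 r0 Kr]]] := psum_bound cf.
have Kr' := inv_coef_bound c0 K0 r0 Kr.
set r' := r * _ in Kr'.
have r'0 : 0 < r' by rewrite mulr_gt0 // addr_gt0 // divr_gt0 // normr_gt0.
have R0 : 0 < r + r' by rewrite addr_gt0.
have small : \forall x \near (0 : C), `|x| * (r + r') <= 4^-1.
  apply/nbhs_normP; exists (4^-1 / (r + r')) => /=; first by rewrite divr_gt0 ?invr_gt0.
  by move=> x /=; rewrite sub0r normrN ltr_pdivlMr // => /ltW.
have fx0 : \forall x \near (0 : C), f x != 0.
  exact: (cvgr_neq0 _ (psum_continuous0 cf) f0).
move: cf fx0 small; apply: filterS3 => x cfx fx0 xr.
have := @cauchy_prod_err c (inv_coef c) K (`|c 0%N|^-1) (r + r') x _ _ R0 xr.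
move=> /(_ _ _)/wrap[].
  by move=> k; apply: (le_trans (Kr k)); rewrite ler_wpM2l ?(ltW K0) //; apply: lerXn2r; rewrite ?nnegrE ?(ltW r0) ?(ltW R0) // lerDl ltW.
  by move=> k; apply: (le_trans (Kr' k)); rewrite ler_wpM2l ?invr_ge0 //; apply: lerXn2r; rewrite ?nnegrE ?(ltW r'0) ?(ltW R0) // lerDr ltW.
move=> err.
have prod1 : psum c x \* psum (inv_coef c) x @ \oo --> (1 : C).
  have one : (fun n => psum (cauchy_prod c (inv_coef c)) x n) @ \oo --> (1 : C).
    apply: cvg_near_cst; exists 1%N => // -[//|n] _ /=.
    rewrite psumE big_ord_recl cauchy_prod_inv // mulr1 big1 ?addr0 // => i _.
    by rewrite cauchy_prod_inv // mul0r.
  rewrite -[1 : C]add0r.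
  rewrite (_ : _ \* _ = (fun n => psum c x n * psum (inv_coef c) x n
     - psum (cauchy_prod c (inv_coef c)) x n) + psum (cauchy_prod c (inv_coef c)) x).
    exact: cvgD.
  by apply/funext => n; rewrite !fctE subrK.
have nz : \forall n \near \oo, psum c x n != 0 by exact: (cvgr_neq0 _ cfx).
rewrite -[(f x)^-1]mulr1.
apply: cvg_trans (cvgM (cvgV fx0 cfx) prod1).
apply: near_eq_cvg; move: nz; apply: filterS => n nzn /=.
by rewrite mulKf.
Qed.

(** Division by [x]. The value at 0 is prescribed because [f 0 / 0] is 0 by convention. *)
Lemma psum_to_shift c f : psum_to c f -> c 0%N = 0 ->
  psum_to (fun k => c k.+1) (fun x => if x == 0 then c 1%N else f x / x).
Proof.
move=> cf c0; move: cf; apply: filterS => x cfx.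
case: eqP => [->|/eqP x0].
  apply: cvg_near_cst; exists 1%N => // -[//|n] _ /=.
  by rewrite psumE big_ord_recl expr0 mulr1 big1 ?addr0 // => i _; rewrite expr0n /= mulr0.
have : (fun n => psum c x n.+1) @ \oo --> f x by rewrite cvg_shiftS.
move=> cfx'; rewrite (_ : psum _ x = fun n => psum c x n.+1 * x^-1).
  exact: cvgMr_tmp.
apply/funext => n; rewrite !psumE big_ord_recl c0 mul0r add0r big_distrl /=.
by apply: eq_bigr => i _; rewrite /bump /= add1n exprS; field.
Qed.

End PowerSeries.

(** * Meromorphic germs *)

Section Germs.
Variable C : numFieldType.
Hypothesis cvg_half : (fun n => (2^-1 : C) ^+ n) @ \oo --> (0 : C).
Implicit Types (c d : nat -> C) (f g : C -> C) (x y z : C).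

Lemma near_dnbhsP (z : C) (P : C -> Prop) :
  (\forall x \near z^', P x) <->
  exists2 e : C, 0 < e & forall x, x != z -> `|x - z| < e -> P x.
Proof.
split=> [/nbhs_normP[e /= e0 H]|[e e0 H]].
  by exists e => // x xz xe; apply: H => //=; rewrite distrC.
by apply/nbhs_normP; exists e => //= x /=; rewrite distrC => xe xz; exact: H.
Qed.

Lemma near_dnbhs_shift (z : C) (P : C -> Prop) :
  (\forall h \near (0 : C)^', P (z + h)) <-> (\forall x \near z^', P x).
Proof.
split=> /near_dnbhsP[e e0 H]; apply/near_dnbhsP; exists e => // x.
  move=> xz xe; rewrite -[x](subrK z) addrC; apply: H; rewrite ?subr0 //.
  by rewrite subr_eq0.
by rewrite subr0 => x0 xe; apply: H; rewrite ?(addrC z) ?addrK // -subr_eq0 addrK.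
Qed.

Lemma near_dnbhs0_scale (a : C) (P : C -> Prop) : a != 0 ->
  (\forall x \near (0 : C)^', P x) -> \forall x \near (0 : C)^', P (a * x).
Proof.
move=> a0 /near_dnbhsP[e e0 H]; have na : 0 < `|a| by rewrite normr_gt0.
apply/near_dnbhsP; exists (e / `|a|); first by rewrite divr_gt0.
move=> x x0; rewrite subr0 ltr_pdivlMr // mulrC -normrM => xe.
by apply: H; rewrite ?mulf_neq0 ?subr0.
Qed.

Lemma near_near (z : C) (P : C -> Prop) : (\forall x \near z^', P x) ->
  \forall y \near z, y != z -> \forall x \near y, P x.
Proof.
move=> /near_dnbhsP[e e0 H]; apply/nbhs_normP; exists e => //= y /= ye yz.
have d0 : 0 < e - `|z - y| by rewrite subr_gt0.
have n0 : 0 < `|z - y| by rewrite normr_gt0 subr_eq0 eq_sym.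
pose d := if e - `|z - y| <= `|z - y| then e - `|z - y| else `|z - y|.
have dd : 0 < d by rewrite /d; case: ifP.
have [d1 d2] : d <= e - `|z - y| /\ d <= `|z - y|.
  rewrite /d; case: (real_leP (gtr0_real d0) (gtr0_real n0)) => // ?; split => //; exact: ltW.
apply/nbhs_normP; exists d => //= x /= xy; apply: H.
  apply: contraL xy => /eqP ->; rewrite distrC.
  by rewrite -real_leNgt ?gtr0_real.
rewrite (_ : x - z = - (y - x) - (z - y)); last by ring.
rewrite (le_lt_trans (ler_normB _ _)) // normrN -ltrBrDr; exact: lt_le_trans d1.
Qed.

Lemma near_infty_inv (P : C -> Prop) : (\forall u \near (0 : C)^', P u^-1) ->
  exists2 e : C, 0 < e & forall x, e^-1 < `|x| -> P x.
Proof.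
move=> /near_dnbhsP[e e0 H]; exists e => // x ex.
have x0 : 0 < `|x| by rewrite (lt_trans _ ex) // invr_gt0.
rewrite -[x]invrK; apply: H; first by rewrite invr_eq0 -normr_gt0.
by rewrite subr0 normfV invf_plt ?posrE.
Qed.

Lemma near_dnbhsI z (P Q : C -> Prop) : (\forall x \near z^', P x) ->
  (\forall x \near z^', Q x) -> \forall x \near z^', P x /\ Q x.
Proof. by apply: filterS2. Qed.

Lemma near_eq0_neq0 f z : (\forall x \near z^', f x = 0) ->
  (\forall x \near z^', f x != 0) -> False.
Proof. by move=> f0 fn; have [x [-> /eqP]] := filter_ex (filterI f0 fn). Qed.

Lemma near_dnbhs_near (z : C) (P : C -> Prop) : (\forall x \near z, P x) ->
  \forall x \near z^', P x.
Proof. exact: nbhs_dnbhs. Qed.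

Lemma cvg_pseries_ext f g : (\forall x \near (0 : C), f x = g x) ->
  cvg_pseries f -> cvg_pseries g.
Proof. by move=> fg [c cf]; exists c; move: fg cf; apply: filterS2 => x ->. Qed.

Lemma cvg_pseries_horner (p : {poly C}) : cvg_pseries (fun x => p.[x]).
Proof.
exists (fun k => p`_k); near=> x; apply: cvg_near_cst; exists (size p) => // n /= pn.
by rewrite -/(psum _ x n) psumE -horner_coef_wide.
Unshelve. all: by end_near. Qed.

Lemma cvg_pseries_id : cvg_pseries (fun x : C => x).
Proof.
have := cvg_pseries_horner 'X; apply: cvg_pseries_ext; near=> x.
by rewrite hornerX.
Unshelve. all: by end_near. Qed.

Lemma cvg_pseries_cst (a : C) : cvg_pseries (fun=> a).
Proof.
have := cvg_pseries_horner a%:P; apply: cvg_pseries_ext; near=> x.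
by rewrite hornerC.
Unshelve. all: by end_near. Qed.

Lemma cvg_pseriesD f g : cvg_pseries f -> cvg_pseries g ->
  cvg_pseries (fun x => f x + g x).
Proof.
move=> [c cf] [d dg]; exists (fun k => c k + d k).
move: cf dg; apply: filterS2 => x cfx dgx.
rewrite [X in X @ _](_ : _ = series (fun k => c k * x ^+ k) + series (fun k => d k * x ^+ k)).
  exact: cvgD.
apply/funext => n; rewrite fctE /series /= -big_split /=; apply: eq_bigr => i _; exact: mulrDl.
Qed.

Lemma cvg_pseriesM f g : cvg_pseries f -> cvg_pseries g ->
  cvg_pseries (fun x => f x * g x).
Proof.
by move=> [c cf] [d dg]; exists (cauchy_prod c d); exact: (psum_to_mul cvg_half).
Qed.

Lemma cvg_pseriesV f : cvg_pseries f -> f 0 != 0 ->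
  cvg_pseries (fun x => (f x)^-1).
Proof. by move=> [c cf] f0; exists (inv_coef c); exact: (psum_to_inv cvg_half). Qed.

Lemma cvg_pseriesX f k : cvg_pseries f -> cvg_pseries (fun x => f x ^+ k).
Proof.
move=> fs; elim: k => [|k IH]; first exact: cvg_pseries_cst.
by under eq_fun do rewrite exprS; exact: cvg_pseriesM.
Qed.

Lemma cvg_pseries_cvg0 f : cvg_pseries f -> f @ (0 : C) --> f 0.
Proof. by case=> c /psum_continuous0. Qed.

Lemma cvg_pseries_order f : cvg_pseries f ->
  (\forall x \near (0 : C), f x = 0) \/
  exists k g, [/\ cvg_pseries g, g 0 != 0 & \forall x \near (0 : C), f x = x ^+ k * g x].
Proof.
case=> c cf; have [c0|] := pselect (forall k, c k = 0).
  left; move: cf; apply: filterS => x cfx; apply/esym.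
  apply: (cvg_unique _ _ cfx); first exact: norm_hausdorff.
  apply: cvg_near_cst; near=> n.
  by rewrite -/(psum _ x n) psumE big1 // => i _; rewrite c0 mul0r.
move=> /existsNP[k /eqP]; move=> ck; right.
have [m cm min_m] := ex_minnP (ex_intro (fun k => c k != 0) k ck).
have {min_m} : forall i, (i < m)%N -> c i = 0.
  by move=> i; apply: contraTeq => /min_m; rewrite -leqNgt.
move: {k ck} cm; elim: m c f cf => [|m IH] c f cf cm c_lt.
  exists 0%N, f; split; [by exists c|by rewrite (psum_at0 cf)|].
  by near=> x; rewrite mul1r.
have c0 : c 0%N = 0 by exact: c_lt.
have /IH := psum_to_shift cf c0; case=> // [i im|k [g [gs g0 fg]]]; first exact: c_lt.
exists k.+1, g; split => //; move: fg; apply: filterS => x.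
case: eqP => [->|/eqP x0 fg]; last by rewrite exprS -mulrA -fg mulrC divfK.
by rewrite exprS !mul0r (psum_at0 cf) c0.
Unshelve. all: by end_near. Qed.


Lemma meromorphic_at_ext f g z : (\forall x \near z^', f x = g x) ->
  meromorphic_at f z -> meromorphic_at g z.
Proof.
move=> /near_dnbhs_shift fg [m [u [us uE]]]; exists m, u; split => //.
by move: fg uE; apply: filterS2 => h ->.
Qed.

Lemma meromorphic_at_holo f g z : cvg_pseries g ->
  (\forall h \near (0 : C)^', f (z + h) = g h) -> meromorphic_at f z.
Proof.
move=> gs fg; exists 0%N, g; split => //.
by move: fg; apply: filterS => h ->; rewrite mul1r.
Qed.

Lemma meromorphic_at_normal f z : meromorphic_at f z ->
  (\forall x \near z^', f x = 0) \/
  exists (k : int) (u : C -> C), [/\ cvg_pseries u, u 0 != 0 &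
    \forall h \near (0 : C)^', f (z + h) = h ^ k * u h].
Proof.
move=> [m [g [gs fg]]]; have nz := nbhs_dnbhs_neq (0 : C).
have [g0|[k [u [us u0 gu]]]] := cvg_pseries_order gs.
  left; apply/near_dnbhs_shift; move/near_dnbhs_near: g0 => g0.
  move: fg g0 nz; apply: filterS3 => h fg g0h h0.
  by move: fg => /eqP; rewrite g0h mulf_eq0 expf_eq0 (negbTE h0) andbF => /eqP.
right; exists (k%:Z - m%:Z), u; split => //; move/near_dnbhs_near: gu => gu.
move: fg gu nz; apply: filterS3 => h fg gu h0.
have hm : h ^+ m != 0 by rewrite expf_neq0.
apply: (mulfI hm); rewrite fg gu mulrA; congr (_ * _).
by rewrite -[h ^+ m]/(h ^ m%:Z) -expfzDr // addrC subrK.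
Qed.

Lemma normal_meromorphic_at f z (k : int) u : cvg_pseries u ->
  (\forall h \near (0 : C)^', f (z + h) = h ^ k * u h) -> meromorphic_at f z.
Proof.
move=> us fu; have nz := nbhs_dnbhs_neq (0 : C); case: k fu => k fu.
  exists 0%N, (fun h => h ^+ k * u h); split.
    by apply: cvg_pseriesM => //; apply: cvg_pseriesX; exact: cvg_pseries_id.
  by move: fu; apply: filterS => h ->; rewrite mul1r.
exists k.+1, u; split => //; move: fu nz; apply: filterS2 => h -> h0.
by rewrite NegzE -exprnN mulrA mulfV ?mul1r // expf_neq0.
Qed.

(** Isolation of zeros: in the normal form [h ^ k * u h], the factor [u] is continuous and nonzero
    at 0. The two alternatives exclude each other and each is an open condition on [z], which the
    identity theorem exploits. *)
Lemma meromorphic_at_dichotomy f z : meromorphic_at f z ->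
  (\forall x \near z^', f x = 0) \/ (\forall x \near z^', f x != 0).
Proof.
move=> /meromorphic_at_normal[|[k [u [us u0 fu]]]]; [by left|right].
have nz := nbhs_dnbhs_neq (0 : C).
have /near_dnbhs_near uh : \forall h \near (0 : C), u h != 0.
  exact: (cvgr_neq0 _ (cvg_pseries_cvg0 us) u0).
apply/near_dnbhs_shift; move: fu nz uh; apply: filterS3 => h -> h0 uh.
by rewrite mulf_neq0 // expfz_neq0.
Qed.

Lemma meromorphic_atM f g z : meromorphic_at f z -> meromorphic_at g z ->
  meromorphic_at (fun x => f x * g x) z.
Proof.
move=> [m [u [us fu]]] [k [v [vs gv]]]; exists (m + k)%N, (fun x => u x * v x).
split; first exact: cvg_pseriesM.
by move: fu gv; apply: filterS2 => h <- <-; rewrite exprD; ring.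
Qed.

Lemma meromorphic_atD f g z : meromorphic_at f z -> meromorphic_at g z ->
  meromorphic_at (fun x => f x + g x) z.
Proof.
move=> [m [u [us fu]]] [k [v [vs gv]]].
exists (m + k)%N, (fun x => x ^+ k * u x + x ^+ m * v x); split.
  by apply: cvg_pseriesD; apply: cvg_pseriesM => //; apply: cvg_pseriesX; exact: cvg_pseries_id.
by move: fu gv; apply: filterS2 => h <- <-; rewrite exprD; ring.
Qed.

Lemma meromorphic_at_horner (p : {poly C}) z : meromorphic_at (fun x => p.[x]) z.
Proof.
apply: (meromorphic_at_holo (cvg_pseries_horner (p \Po ('X + z%:P)))).
near=> h; by rewrite horner_comp !hornerE addrC.
Unshelve. all: by end_near. Qed.

Lemma meromorphic_at_cst (a : C) z : meromorphic_at (fun=> a) z.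
Proof.
apply: meromorphic_at_ext (meromorphic_at_horner a%:P z).
by near=> x; rewrite hornerC.
Unshelve. all: by end_near. Qed.

Lemma meromorphic_atV f z : meromorphic_at f z ->
  meromorphic_at (fun x => (f x)^-1) z.
Proof.
move=> /meromorphic_at_normal[f0|[k [u [us u0 fu]]]].
  apply: meromorphic_at_ext (meromorphic_at_cst 0 z).
  by move: f0; apply: filterS => x ->; rewrite invr0.
apply: (@normal_meromorphic_at _ _ (- k) _ (cvg_pseriesV us u0)).
by move: fu; apply: filterS => h ->; rewrite invfM invr_expz.
Qed.

Lemma meromorphic_at_sum (I : Type) (r : seq I) (P : pred I) (F : I -> C -> C) z :
  (forall i, P i -> meromorphic_at (F i) z) ->
  meromorphic_at (fun x => \sum_(i <- r | P i) F i x) z.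
Proof.
move=> Fm; elim: r => [|i r IH].
  by under eq_fun do rewrite big_nil; exact: meromorphic_at_cst.
have [Pi|/negbTE Pi] := boolP (P i); last by under eq_fun do rewrite big_cons Pi.
under eq_fun do rewrite big_cons Pi.
by apply: meromorphic_atD => //; exact: Fm.
Qed.

Lemma meromorphic_at_prod (I : Type) (r : seq I) (P : pred I) (F : I -> C -> C) z :
  (forall i, P i -> meromorphic_at (F i) z) ->
  meromorphic_at (fun x => \prod_(i <- r | P i) F i x) z.
Proof.
move=> Fm; elim: r => [|i r IH].
  by under eq_fun do rewrite big_nil; exact: meromorphic_at_cst.
have [Pi|/negbTE Pi] := boolP (P i); last by under eq_fun do rewrite big_cons Pi.
under eq_fun do rewrite big_cons Pi.
by apply: meromorphic_atM => //; exact: Fm.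
Qed.

Definition meromorphic_mx m n (F : C -> 'M[C]_(m, n)) z :=
  forall i j, meromorphic_at (fun x => F x i j) z.

Lemma meromorphic_mxM m n p (F : C -> 'M[C]_(m, n)) (G : C -> 'M[C]_(n, p)) z :
  meromorphic_mx F z -> meromorphic_mx G z ->
  meromorphic_mx (fun x => F x *m G x) z.
Proof.
move=> Fm Gm i j; under eq_fun do rewrite mxE.
by apply: meromorphic_at_sum => k _; exact: meromorphic_atM.
Qed.

Lemma meromorphic_mx_sub m n p l (F : C -> 'M[C]_(m, n)) (f : 'I_p -> 'I_m)
    (g : 'I_l -> 'I_n) z :
  meromorphic_mx F z -> meromorphic_mx (fun x => mxsub f g (F x)) z.
Proof. by move=> Fm i j; under eq_fun do rewrite mxE; exact: Fm. Qed.

Lemma meromorphic_at_det n (F : C -> 'M[C]_n) z :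
  meromorphic_mx F z -> meromorphic_at (fun x => \det (F x)) z.
Proof.
move=> Fm; apply: meromorphic_at_sum => s _; apply: meromorphic_atM.
  exact: meromorphic_at_cst.
by apply: meromorphic_at_prod => i _; exact: Fm.
Qed.

Lemma meromorphic_mxV n (F : C -> 'M[C]_n) z :
  meromorphic_mx F z -> meromorphic_mx (fun x => invmx (F x)) z.
Proof.
move=> Fm i j; have [d0|d0] := meromorphic_at_dichotomy (meromorphic_at_det Fm).
  (* On a singular matrix [invmx] is the identity map, so the germ is that of [F] itself. *)
  apply: meromorphic_at_ext (Fm i j); move: d0; apply: filterS => x d0.
  by rewrite /invmx unitmxE d0 unitr0.
apply: (@meromorphic_at_ext (fun x => (\det (F x))^-1 * cofactor (F x) j i)).
  move: d0; apply: filterS => x d0.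
  by rewrite /invmx unitmxE unitfE d0 !mxE.
apply: meromorphic_atM; first by apply: meromorphic_atV; exact: meromorphic_at_det.
apply: meromorphic_atM; first exact: meromorphic_at_cst.
apply: meromorphic_at_det => k l.
by under eq_fun do rewrite !mxE; exact: Fm.
Qed.

(* If f(x) = x^k u(x) with u(0) != 0, then f(qx)/f(x) tends to q^k at 0. *)
Lemma qshift_eigen f (q a : C) : q != 0 -> meromorphic_at f 0 ->
    (\forall x \near (0 : C)^', f (q * x) = a * f x) ->
  (\forall x \near (0 : C)^', f x = 0) \/ exists k : int, a = q ^ k.
Proof.
move=> q0 /meromorphic_at_normal[|[k [u [us u0 fu]]] fq]; [by left|right].
exists k; have nz := nbhs_dnbhs_neq (0 : C).
have cu : u @ (0 : C)^' --> u 0.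
  by apply: cvg_trans (cvg_pseries_cvg0 us); apply: cvg_app; exact: nbhs_dnbhs.
have cuq : u \o ( *%R q) @ (0 : C)^' --> u 0.
  apply: cvg_comp cu; move=> P P0; exact: near_dnbhs0_scale.
have : (fun x => q ^ k * u (q * x)) @ (0 : C)^' --> q ^ k * u 0 by exact: cvgMl_tmp.
have : (fun x => a * u x) @ (0 : C)^' --> a * u 0 by exact: cvgMl_tmp.
move=> c1 c2; apply: (mulIf u0).
apply: (cvg_unique _ c1); first exact: norm_hausdorff.
apply: cvg_trans c2; apply: near_eq_cvg.
have fu0 : \forall x \near (0 : C)^', f x = x ^ k * u x.
  by move: fu; apply: filterS => x; rewrite add0r.
have fuq := near_dnbhs0_scale q0 fu0.
near=> x.
have x0 : x != 0 by near: x.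
have : f (q * x) = a * f x by near: x.
rewrite (near fu0 x) // (near fuq x) // expfzMl => E.
by apply: (mulfI (expfz_neq0 k x0)); rewrite mulrCA mulrA E mulrCA.
Unshelve. all: by end_near. Qed.

End Germs.

(** * Minors and coordinate subspaces *)

Section LinearAlgebra.

Lemma row_free_colsub (F : fieldType) m n (L : 'M[F]_(m, n)) : row_free L ->
  exists f : 'I_m -> 'I_n, colsub f L \in unitmx.
Proof.
rewrite -row_leq_rank -mxrank_tr => Lf; have LT : row_full L^T.
  by rewrite -col_leq_rank.
exists (fullrankfun LT); have := fullrowsub_unit LT.
by rewrite -unitmx_tr trmx_mxsub trmxK.
Qed.

Lemma colsub_unit_inj (F : fieldType) m n (L : 'M[F]_(m, n)) (f : 'I_m -> 'I_n) :
  colsub f L \in unitmx -> injective f.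
Proof.
move=> Lf i j fij; apply/eqP; apply: contraLR Lf => ij.
rewrite unitmxE unitfE negbK -det_tr; apply/eqP.
by apply: (determinant_alternate ij) => k; rewrite !mxE fij.
Qed.

Lemma colsub_unit_free (F : fieldType) m n (L : 'M[F]_(m, n)) (f : 'I_m -> 'I_n) :
  colsub f L \in unitmx -> row_free L.
Proof.
rewrite -row_free_unit -!row_leq_rank => /leq_trans; apply.
have -> : colsub f L = L *m colsub f 1%:M by rewrite mulmx_colsub mulmx1.
exact: mxrankM_maxl.
Qed.

Lemma colsub_diag (F : fieldType) m n p (X : 'M[F]_(m, n)) (D : 'rV[F]_n)
    (f : 'I_p -> 'I_n) :
  colsub f (X *m diag_mx D) = colsub f X *m diag_mx (colsub f D).
Proof. by apply/matrixP => i j; rewrite !mul_mx_diag !mxE. Qed.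

End LinearAlgebra.

Section Coordinates.
Variable C : numFieldType.
Hypothesis cvg_half : (fun n => (2^-1 : C) ^+ n) @ \oo --> (0 : C).

(** Each maximal minor is meromorphic, so it vanishes on a whole punctured neighbourhood or nowhere
    on one. There are finitely many; if all vanished, they would do so at a common point, against
    full rank. Finite functions index the minors to make this intersection finite. *)
Lemma generic_minor m n (N : C -> 'M[C]_(m, n)) z : meromorphic_mx N z ->
    (\forall x \near z^', row_free (N x)) ->
  exists f : 'I_m -> 'I_n, \forall x \near z^', colsub f (N x) \in unitmx.
Proof.
move=> Nm Nf; have dich f : (\forall x \near z^', \det (colsub f (N x)) = 0) \/
    (\forall x \near z^', \det (colsub f (N x)) != 0).
  apply: meromorphic_at_dichotomy; apply: (meromorphic_at_det cvg_half).
  exact: meromorphic_mx_sub.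
have [/existsNP[f Hf]|all0] := pselect (~ forall f : {ffun 'I_m -> 'I_n},
    \forall x \near z^', \det (colsub f (N x)) = 0).
  exists f; case: (dich f) => //; apply: filterS => x.
  by rewrite unitmxE unitfE.
move/contrapT: all0 => all0.
have : \forall x \near z^', forall f : {ffun 'I_m -> 'I_n}, \det (colsub f (N x)) = 0.
  exact: filter_forall.
move=> all0'; have [x [Nx0]] := filter_ex (filterI all0' Nf).
move=> /row_free_colsub[f]; rewrite unitmxE unitfE.
have -> : colsub f (N x) = colsub (finfun f) (N x).
  by apply/matrixP => i j; rewrite !mxE ffunE.
by rewrite Nx0 eqxx.
Qed.

(* Normalized to be the identity on the columns [f], the matrix N becomes some E
   with E(qx) D = D_f E(x); by [qshift_eigen] a nonzero entry (k, j) of E makes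
   D_(f k) and D_j congruent, so that E is a matrix of coordinate vectors. *)
Lemma eigen_columns q m n (D : 'rV[C]_n) (N : C -> 'M[C]_(m, n)) (B : C -> 'M[C]_m) :
    q != 0 -> (forall j, D 0 j != 0) ->
    (forall i j, i != j -> ~ congruent_mod_qZ q (D 0 i) (D 0 j)) ->
    meromorphic_mx N 0 -> (\forall x \near (0 : C)^', row_free (N x)) ->
    (\forall x \near (0 : C)^', N (q * x) *m diag_mx D = B x *m N x) ->
  exists2 f : 'I_m -> 'I_n, (\forall x \near (0 : C)^', colsub f (N x) \in unitmx) &
    forall i j, j \notin codom f -> \forall x \near (0 : C)^', N x i j = 0.
Proof.
move=> q0 D0 Dq Nm Nf NB; have [f Nu] := generic_minor Nm Nf; exists f => // i j jf.
pose E x := invmx (colsub f (N x)) *m N x.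
have Em : meromorphic_mx E 0.
  apply: meromorphic_mxM => //; apply: meromorphic_mxV => //.
  exact: meromorphic_mx_sub.
have ED : \forall x \near (0 : C)^', E (q * x) *m diag_mx D = diag_mx (colsub f D) *m E x.
  have Nqu := near_dnbhs0_scale q0 Nu.
  move: NB Nu Nqu; apply: filterS3 => x NB Nu Nqu.
  have := congr1 (colsub f) NB; rewrite colsub_diag -mulmx_colsub => NBf.
  rewrite /E -mulmxA NB; apply: (canLR (mulKmx Nqu)).
  by rewrite !mulmxA NBf mulmxK.
have E0 k : \forall x \near (0 : C)^', E x k j = 0.
  have fkj : f k != j by apply: contraNneq jf => <-; exact: codom_f.
  have : \forall x \near (0 : C)^', E (q * x) k j = D 0 (f k) / D 0 j * E x k j.
    move: ED; apply: filterS => x /matrixP/(_ k j).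
    rewrite mul_mx_diag mul_diag_mx !mxE => /(canRL (mulfK (D0 j))) ->.
    by rewrite mulrAC.
  case/(qshift_eigen q0 (Em k j)) => // -[l Dl].
  by case: (Dq _ _ fkj); exists l.
have : \forall x \near (0 : C)^', forall k, E x k j = 0 by exact: filter_forall.
move: Nu; apply: filterS2 => x Nu Ex0.
have -> : N x = colsub f (N x) *m E x by rewrite /E mulKVmx.
by rewrite mxE big1 // => k _; rewrite Ex0 mulr0.
Qed.

End Coordinates.

(** * Identity theorem *)

Section IdentityTheorem.
Variables (R : realType) (C : numFieldType).

Lemma open_near_dnbhs (P : C -> Prop) : open [set z : C | \forall x \near z^', P x].
Proof.
rewrite openE => z /= Pz; move: (near_near Pz); apply: filterS => y.
have [->//|yz /(_ isT)] := eqVneq y z; exact: near_dnbhs_near.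
Qed.

(** By the dichotomy, the parameters with vanishing germ and those with nonvanishing germ form two
    disjoint open sets covering the segment, which is connected. *)
Lemma meromorphic_path (f : C -> C) (ga : R -> C) : continuous ga ->
    (forall t : R, 0 <= t <= 1 -> meromorphic_at f (ga t)) ->
  (\forall x \near (ga 0)^', f x = 0) -> \forall x \near (ga 1)^', f x = 0.
Proof.
move=> gac fm fa.
have opn (P : C -> Prop) : open (ga @^-1` [set z : C | \forall x \near z^', P x]).
  apply: (@open_comp R C ga); last exact: open_near_dnbhs.
  by move=> t _; exact: gac.
pose Z := ga @^-1` [set z : C | \forall x \near z^', f x = 0].
pose NZ := ga @^-1` [set z : C | \forall x \near z^', f x != 0].
have ZE : `[(0 : R), 1]%classic `&` Z = `[(0 : R), 1]%classic.
  apply: segment_connected.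
  - by exists 0; split; rewrite /= ?in_itv /= ?lexx ?ler01.
  - by exists Z => //; exact: opn.
  - exists (~` NZ); first by rewrite closedC; exact: opn.
    apply/seteqP; split => t [t01 Zt]; split => //.
      by move=> NZt; have [x [/eqP ? /negP]] := filter_ex (filterI Zt NZt).
    rewrite /= in_itv /= in t01.
    by case: (meromorphic_at_dichotomy (fm t t01)).
have : `[(0 : R), 1]%classic 1 by rewrite /= in_itv /= lexx ler01.
by rewrite -ZE => -[].
Qed.

End IdentityTheorem.

Section ComplexPlane.
Local Open Scope complex_scope.
Variable R : realType.
Local Notation C := (R[i] : numFieldType).
Implicit Types (f g : C -> C) (z a b : C).

Lemma norm_real_complex (t : R) : `|t%:C| = `|t|%:C :> C.
Proof. by rewrite normc_def /= expr0n /= addr0 sqrtr_sqr. Qed.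

Lemma gt0_complexE (e : C) : 0 < e -> e = (complex.Re e)%:C /\ 0 < complex.Re e.
Proof. by case: e => a b; rewrite ltcE /= => /andP[/eqP -> ->]. Qed.

Lemma continuous_real_complex : continuous (real_complex R : R -> C).
Proof.
move=> t; apply/(@cvgrPdist_lt C C R (nbhs t) _ (real_complex R)) => e /gt0_complexE[-> e0].
apply/nbhs_normP; exists (complex.Re e) => //= s /=.
by rewrite -rmorphB norm_real_complex ltcR.
Qed.

Lemma cvg_half_complex : (fun n => (2^-1 : C) ^+ n) @ \oo --> (0 : C).
Proof.
have : (fun n => ((2^-1 : R) ^+ n)%:C) @ \oo --> ((0 : R)%:C : C).
  apply: (cvg_comp _ (real_complex R)); last exact: continuous_real_complex.
  by apply: cvg_expr; rewrite ger0_norm ?invr_ge0 // invf_lt1 ?ltr1n.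
rewrite (_ : (fun n => _) = fun n => (2^-1 : C) ^+ n) //.
by apply/funext => n; rewrite rmorphXn /= fmorphV rmorph_nat.
Qed.

Lemma meromorphic_segment f a b :
    (forall t : R, 0 <= t <= 1 -> meromorphic_at f (a + t%:C * (b - a))) ->
  (\forall x \near a^', f x = 0) -> \forall x \near b^', f x = 0.
Proof.
move=> fm fa; have := @meromorphic_path R C f (fun t : R => a + t%:C * (b - a) : C).
rewrite mul0r addr0 mul1r [a + _]addrC subrK; apply => // t.
apply: cvgD; first exact: cvg_cst.
by apply: cvgMr_tmp; exact: continuous_real_complex.
Qed.

End ComplexPlane.

(** * Meromorphic functions on the Riemann sphere *)

Section Removable.
Variable C : numFieldType.
Hypothesis cvg_half : (fun n => (2^-1 : C) ^+ n) @ \oo --> (0 : C).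
Implicit Types (f g : C -> C) (z : C).

Definition removable_at f z :=
  exists2 g, cvg_pseries g & \forall h \near (0 : C)^', f (z + h) = g h.

Definition analytic_at f z :=
  exists2 g, cvg_pseries g & \forall h \near (0 : C), f (z + h) = g h.

Lemma removable_at_ext f g z : (\forall x \near z^', f x = g x) ->
  removable_at f z -> removable_at g z.
Proof.
move=> /near_dnbhs_shift fg [u us fu]; exists u => //.
by move: fg fu; apply: filterS2 => h ->.
Qed.

Lemma removable_at_meromorphic f z : removable_at f z -> meromorphic_at f z.
Proof. by case=> g gs fg; exact: meromorphic_at_holo gs fg. Qed.

Lemma analytic_at_removable f z : analytic_at f z -> removable_at f z.
Proof. by case=> g gs fg; exists g => //; exact: near_dnbhs_near. Qed.

Lemma removable_atM f g z : removable_at f z -> removable_at g z ->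
  removable_at (fun x => f x * g x) z.
Proof.
move=> [u us fu] [v vs gv]; exists (fun h => u h * v h); first exact: cvg_pseriesM.
by move: fu gv; apply: filterS2 => h -> ->.
Qed.

Lemma removable_atD f g z : removable_at f z -> removable_at g z ->
  removable_at (fun x => f x + g x) z.
Proof.
move=> [u us fu] [v vs gv]; exists (fun h => u h + v h); first exact: cvg_pseriesD.
by move: fu gv; apply: filterS2 => h -> ->.
Qed.

Lemma analytic_at_horner (p : {poly C}) z : analytic_at (fun x => p.[x]) z.
Proof.
exists (fun h => (p \Po ('X + z%:P)).[h]); first exact: cvg_pseries_horner.
near=> h; by rewrite horner_comp !hornerE addrC.
Unshelve. all: by end_near. Qed.

Lemma removable_at_horner (p : {poly C}) z : removable_at (fun x => p.[x]) z.
Proof. exact/analytic_at_removable/analytic_at_horner. Qed.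

Lemma cvg_near_dist_lt f z (l e : C) : f x @[x --> z] --> l -> 0 < e ->
  \forall x \near z, `|l - f x| < e.
Proof. by move=> /(@cvgrPdist_lt C C C (nbhs z) _ f l); exact. Qed.

Lemma cvg_subr (a b : C) : x - a @[x --> b] --> b - a.
Proof. exact: (@cvgB C C C (nbhs b) _ id (fun=> a) b a (@cvg_id _ _) (@cvg_cst _ _ _ _ _)). Qed.

Lemma cvg_addl (a b : C) : a + x @[x --> b] --> a + b.
Proof. exact: (@cvgD C C C (nbhs b) _ (fun=> a) id a b (@cvg_cst _ _ _ _ _) (@cvg_id _ _)). Qed.

Lemma near_subr (a b : C) (P : C -> Prop) : (\forall x \near b - a, P x) ->
  \forall x \near b, P (x - a).
Proof. exact: cvg_subr. Qed.

Lemma near_addl (a b : C) (P : C -> Prop) : (\forall x \near a + b, P x) ->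
  \forall x \near b, P (a + x).
Proof. exact: cvg_addl. Qed.

Lemma near_subr0 (z : C) (P : C -> Prop) : (\forall x \near (0 : C), P x) ->
  \forall x \near z, P (x - z).
Proof. by move=> P0; apply: (@near_subr z z); rewrite subrr. Qed.

Lemma analytic_at_continuous f z : analytic_at f z -> f x @[x --> z] --> f z.
Proof.
move=> [g gs fg]; have gc := cvg_pseries_cvg0 gs.
have gz : g 0 = f z by rewrite -(nbhs_singleton fg) addr0.
have sz : (fun x => x - z) @ z --> (0 : C).
  by rewrite -(subrr z); exact: cvg_subr.
rewrite -gz; apply: cvg_trans (cvg_comp _ _ sz gc).
have fg' : \forall x \near z, g (x - z) = f x.
  by have := near_subr0 z fg; apply: filterS => x <-; rewrite addrC subrK.
exact: (@near_eq_cvg _ _ (nbhs z)).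
Qed.

Lemma cvg_shift_dnbhs0 f z (l : C) : f x @[x --> z^'] --> l ->
  f (z + h) @[h --> (0 : C)^'] --> l.
Proof.
move=> fl P Pl; apply/(near_dnbhs_shift z (fun x => P (f x))); exact: fl.
Qed.

Lemma cvg_removable f z (l : C) : meromorphic_at f z -> f x @[x --> z^'] --> l ->
  removable_at f z.
Proof.
move=> /meromorphic_at_normal[f0 _|[[k|k] [u [us u0 fu]]] /cvg_shift_dnbhs0 fl].
- exists (fun=> 0); first exact: cvg_pseries_cst.
  by apply/(near_dnbhs_shift z (fun x => f x = 0)).
- exists (fun h => h ^+ k * u h) => //.
  by apply: cvg_pseriesM => //; apply: cvg_pseriesX => //; exact: cvg_pseries_id.
(* With a pole of order [k + 1], the function [h ^ (k + 1) * f (z + h)] would tend to 0, because [f]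
   has a limit, and also to [u 0], which is not 0. *)
exfalso; have id0 : (fun h : C => h) @ (0 : C)^' --> (0 : C) by exact: nbhs_dnbhs.
have h0 : (fun h : C => h ^+ k.+1 * f (z + h)) @ (0 : C)^' --> (0 : C).
  have hk : (fun h : C => h ^+ k.+1) @ (0 : C)^' --> (0 : C).
    apply: (cvg_trans _ (_ : h ^+ k.+1 @[h --> (0 : C)] --> (0 : C))).
      by apply: cvg_app; exact: nbhs_dnbhs.
    have := cvg_pseries_cvg0 (cvg_pseriesX cvg_half k.+1 (cvg_pseries_id C)).
    by rewrite expr0n.
  have := cvgM hk fl; rewrite mul0r; exact.
have cu : u h @[h --> (0 : C)^'] --> u 0.
  by apply: cvg_trans (cvg_pseries_cvg0 us); apply: cvg_app; exact: nbhs_dnbhs.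
move/eqP: u0; apply; apply: (cvg_unique _ cu); first exact: norm_hausdorff.
apply: cvg_trans h0; apply: near_eq_cvg; have nz := nbhs_dnbhs_neq (0 : C).
move: fu nz; apply: filterS2 => h -> h0.
by rewrite NegzE -exprnN mulrA mulfV ?mul1r // expf_neq0.
Qed.

(** No series is re-expanded at [y]: the expansion at [z] is continuous near [z], so [f] has a limit
    at [y], and a meromorphic germ with a limit has no pole. *)
Lemma near_punctured_removable f z : (forall x, meromorphic_at f x) ->
  \forall y \near z, y != z -> removable_at f y.
Proof.
move=> fm; have [m [g [[c gc] fg]]] := fm z.
have := psum_to_continuous gc; have := near_near fg.
set P := fun y => _ -> \forall x \near y, _; move=> fP gP.
move: (near_subr0 z gP) (near_subr0 z fP); apply: filterS2 => y gy fy yz.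
have yz0 : y - z != 0 by rewrite subr_eq0.
have shifty : (fun x => x - z) @ y --> (y - z).
  exact: cvg_subr.
have fE : \forall x \near y^', f x = (x - z) ^- m * g (x - z).
  apply: near_dnbhs_near.
  have zn : \forall x \near y, x - z != 0 by exact: (cvgr_neq0 _ shifty yz0).
  have := near_subr (fy yz0); move: zn.
  apply: filterS2 => x xz /= <-; rewrite [z + _]addrC subrK mulKf //.
  by rewrite expf_neq0.
have cv : (fun x => (x - z) ^- m * g (x - z)) @ y --> (y - z) ^- m * g (y - z).
  have cX : (x - z) ^+ m @[x --> y] --> (y - z) ^+ m.
    have := analytic_at_continuous (analytic_at_horner (('X - z%:P) ^+ m) y).
    by rewrite !hornerE; under eq_fun do rewrite !hornerE.
  have cI : (x - z) ^- m @[x --> y] --> (y - z) ^- m.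
    by apply: (@cvgV _ _ (nbhs y)) => //; rewrite expf_neq0.
  have cG : g (x - z) @[x --> y] --> g (y - z) by exact: (cvg_comp _ _ shifty gy).
  exact: (@cvgM _ _ (nbhs y) _ _ _ _ _ cI cG).
apply: (cvg_removable (l := (y - z) ^- m * g (y - z))) => //.
apply: cvg_trans (cvg_trans (cvg_app _ (@nbhs_dnbhs C y)) cv).
by apply: near_eq_cvg; move: fE; apply: filterS => x ->.
Qed.

(** An expansion [G z] is chosen at every point and [F z] is its constant term. The choices are
    compatible because [G (z + h) 0] and [G z h] are both the limit of [f] at [z + h]. *)
Lemma removable_extension f : (forall z, removable_at f z) ->
  exists2 F : C -> C, (forall z, analytic_at F z) &
    forall z, \forall x \near z^', F x = f x.
Proof.
move=> fr; have /choice[G GP] : forall z, exists g : C -> C, cvg_pseries g /\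
    \forall h \near (0 : C)^', f (z + h) = g h.
  by move=> z; have [g] := fr z; exists g.
have FG z : \forall h \near (0 : C), G (z + h) 0 = G z h.
  have [[c gc] fg] := GP z; have := near_near fg; have := psum_to_continuous gc.
  apply: filterS2 => h Gh; have [->|h0 /(_ isT) fh] := eqVneq h 0; first by rewrite addr0.
  have [gs' fg'] := GP (z + h).
  have c1 : G (z + h) j @[j --> (0 : C)^'] --> G (z + h) 0.
    by apply: cvg_trans (cvg_pseries_cvg0 gs'); apply: cvg_app; exact: nbhs_dnbhs.
  apply: (cvg_unique _ c1); first exact: norm_hausdorff.
  have sh : (fun j => h + j) @ (0 : C) --> h.
    by have := @cvg_addl h 0; rewrite addr0.
  have c2 : G z (h + j) @[j --> (0 : C)^'] --> G z h.
    apply: cvg_trans (cvg_comp _ _ sh Gh); apply: cvg_app; exact: nbhs_dnbhs.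
  apply: cvg_trans c2; apply: near_eq_cvg.
  move: fh; rewrite -{1}(addr0 h) => /near_addl/near_dnbhs_near; move: fg'; apply: filterS2 => j <- <-.
  by rewrite addrA.
exists (fun z => G z 0) => z.
  by exists (G z); [case: (GP z)|exact: FG].
apply/near_dnbhs_shift; have [_ fg] := GP z.
by move: (near_dnbhs_near (FG z)) fg; apply: filterS2 => h -> ->.
Qed.

End Removable.

(* If g(h) = g(0) + h^k u(h) with u(0) != 0 and e^k = g(0) / u(0), then |g| grows
   along the half-line directed by e. *)
Lemma local_max_constant (C : numClosedFieldType) (g : C -> C) :
    cvg_pseries g -> (\forall h \near (0 : C), `|g h| <= `|g 0|) ->
  \forall h \near (0 : C), g h = g 0.
Proof.
move=> gs gmax.
have [|[k [u [us u0 gu]]]] := cvg_pseries_order (cvg_pseriesD gs (cvg_pseries_cst (- g 0))).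
  by apply: filterS => h /eqP; rewrite subr_eq0 => /eqP.
have [g0|g0] := eqVneq (g 0) 0.
  by move: gmax; rewrite g0; apply: filterS => h; rewrite normr0 normr_le0 => /eqP.
have k0 : (0 < k)%N.
  case: k gu => // /nbhs_singleton /=; rewrite subrr mul1r => u00.
  by rewrite -u00 eqxx in u0.
pose e := k.-root (g 0 / u 0).
have ek : e ^+ k = g 0 / u 0 by rewrite rootCK.
have e0 : 0 < `|e|.
  by rewrite normr_gt0; apply: contra_neq (mulf_neq0 g0 (invr_neq0 u0)) => e0;
    rewrite -ek e0 expr0n gtn_eqF.
have nu : \forall h \near (0 : C), `|u 0 - u h| < `|u 0| / 2.
  by apply: cvg_near_dist_lt (cvg_pseries_cvg0 us) _; rewrite divr_gt0 ?normr_gt0.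
have /nbhs_normP[r /= r0 H] : \forall h \near (0 : C),
    [/\ g h + - g 0 = h ^+ k * u h, `|u 0 - u h| < `|u 0| / 2 & `|g h| <= `|g 0|].
  by move: gu nu gmax; apply: filterS3 => h.
pose t := r / 2 / `|e|.
have t0 : 0 < t by rewrite !divr_gt0.
have [|geq ueq gle] := H (t * e).
  rewrite /= sub0r normrN normrM (gtr0_norm t0) /t divfK ?gt_eqF //.
  by rewrite ltr_pdivrMr // ltr_pMr // ltr1n.
pose w := u (t * e) / u 0.
have w1 : `|w - 1| < 2^-1.
  rewrite -(ltr_pM2r (x := `|u 0|)) ?normr_gt0 // -normrM mulrBl mul1r divfK //.
  by rewrite distrC [ltRHS]mulrC.
have gE : g (t * e) = g 0 * (1 + t ^+ k * w).
  apply/eqP; rewrite -subr_eq0 mulrDr mulr1 opprD addrA geq /w exprMn ek subr_eq0.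
  by apply/eqP; field.
move: gle; rewrite gE normrM -[leRHS]mulr1 ler_pM2l ?normr_gt0 // => le1.
have tk0 : 0 < t ^+ k by rewrite exprn_gt0.
have : `|1 + t ^+ k| <= 1 + t ^+ k * 2^-1.
  have -> : 1 + t ^+ k = (1 + t ^+ k * w) - t ^+ k * (w - 1) by ring.
  rewrite (le_trans (ler_normB _ _)) // lerD // normrM gtr0_norm //.
  by rewrite ler_wpM2l ?ltW.
rewrite gtr0_norm ?addr_gt0 // lerD2l ler_pdivlMr // ger_pMr //.
by rewrite (ler_nat _ 2 1).
Qed.

(** * Identity theorem up to infinity and maximum principle *)

Section RiemannSphere.
Local Open Scope complex_scope.
Variable R : realType.
Local Notation C := (R[i] : numFieldType).
Implicit Types (f g : C -> C) (z a b : C).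

(** The compact set is the image of a real square. It may exceed the disc: it is only needed that
    all points outside it have large modulus. *)
Lemma real_image_compact (r : R) :
  exists2 K : set C, compact K & forall z, `|z| <= r%:C -> K z.
Proof.
pose phi (p : R * R) : C := p.1%:C + 'i%C * p.2%:C.
have phic : continuous phi.
  move=> p; apply: cvgD.
    by apply: (cvg_comp _ _ cvg_fst); exact: continuous_real_complex.
  apply: cvgMl_tmp.
  by apply: (cvg_comp _ _ cvg_snd); exact: continuous_real_complex.
exists (phi @` (`[- r, r]%classic `*` `[- r, r]%classic)).
  apply: continuous_compact; first exact: continuous_subspaceT.
  by apply: compact_setX; exact: segment_compact.
move=> z zr; exists (complex.Re z, complex.Im z); last by rewrite /phi -complexE.
have re : `|complex.Re z| <= r by rewrite -lecR (le_trans (normc_ge_Re z)).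
have im : `|complex.Im z| <= r.
  rewrite -lecR -normrN -ReiNIm (le_trans (normc_ge_Re _)) // normrM.
  by rewrite (_ : `|'i%C| = 1) ?mulr1 // normc_def /= expr0n expr1n add0r sqrtr1.
by split; rewrite /= in_itv /= -ler_norml.
Qed.

(** The norm of [R[i]] takes its values in [R[i]]; the extreme value theorem needs a function with
    values in [R]. *)
Definition modulus z : R := complex.Re `|z|.

Lemma modulusE z : `|z| = (modulus z)%:C.
Proof. by rewrite /modulus RRe_real // normr_real. Qed.

Lemma modulus_le z w : (modulus z <= modulus w) = (`|z| <= `|w|).
Proof. by rewrite !modulusE lecR. Qed.

Lemma continuous_modulus f z : f x @[x --> z] --> f z ->
  modulus (f x) @[x --> z] --> modulus (f z).
Proof.
move=> fc; apply/(@cvgrPdist_lt R R C (nbhs z)) => e e0.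
have ec0 : (0 : C) < e%:C by rewrite ltcR.
have : \forall x \near z, `|f z - f x| < e%:C by exact: (cvg_near_dist_lt fc).
apply: filterS => x fx.
rewrite -ltcR -norm_real_complex rmorphB /= -!modulusE.
exact: le_lt_trans (ler_dist_dist _ _) fx.
Qed.

Lemma meromorphic_eq0 f a b : (forall z, meromorphic_at f z) ->
  (\forall x \near a^', f x = 0) -> \forall x \near b^', f x = 0.
Proof. by move=> fm; apply: meromorphic_segment. Qed.

(** The segment lies on the half-line from 0 through [z], so it avoids the possible singularity at
    0. The factor [s] gives [w] the modulus [|z| + 1/e]. *)
Lemma ray_to_infty z (e : C) : z != 0 -> 0 < e -> exists w : C,
  (\forall x \near w, e^-1 < `|x|) /\
  forall t : R, 0 <= t <= 1 -> w + t%:C * (z - w) != 0.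
Proof.
move=> z0 e0; have nz : 0 < `|z| by rewrite normr_gt0.
pose s : C := 1 + (e * `|z|)^-1.
have s0 : 0 < s by rewrite addr_gt0 // invr_gt0 mulr_gt0.
exists (s * z); split.
  have sz : e^-1 < `|s * z|.
    rewrite normrM gtr0_norm // mulrDl mul1r invfM divfK ?gt_eqF //.
    by rewrite ltrDr.
  apply/nbhs_normP; exists (`|s * z| - e^-1) => /=; first by rewrite subr_gt0.
  move=> x /= szx; have := lerB_dist (s * z) x => /le_lt_trans/(_ szx).
  by rewrite ltrD2l ltrN2.
move=> t /andP[t0 t1].
rewrite (_ : _ + _ = z * (s * (1 - t%:C) + t%:C)); last by ring.
rewrite mulf_neq0 // gt_eqF //.
have [->|tn0] := eqVneq t 0; first by rewrite subr0 mulr1 addr0.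
rewrite ltr_wpDl // ?ltcR ?lt_def ?tn0 //.
by rewrite mulr_ge0 ?(ltW s0) // subr_ge0 -[1]/((1 : R)%:C) lecR.
Qed.

Lemma meromorphic_eq0_infty f z : (forall z, z != 0 -> meromorphic_at f z) ->
    (\forall u \near (0 : C)^', f u^-1 = 0) -> z != 0 ->
  \forall x \near z^', f x = 0.
Proof.
move=> fm /(@near_infty_inv C (fun x => f x = 0))[e e0 H] z0; have [w [we wz]] := ray_to_infty z0 e0.
apply: (@meromorphic_segment R f w); first by move=> t t01; exact/fm/wz.
by apply: near_dnbhs_near; move: we; apply: filterS => x; exact: H.
Qed.

Lemma meromorphic_neq0_infty f z : (forall z, z != 0 -> meromorphic_at f z) ->
    (\forall u \near (0 : C)^', f u^-1 != 0) -> z != 0 ->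
  \forall x \near z^', f x != 0.
Proof.
move=> fm /(@near_infty_inv C (fun x => f x != 0))[e e0 H] z0; have [w [we wz]] := ray_to_infty z0 e0.
have [f0|//] := meromorphic_at_dichotomy (fm z z0).
have f0w : \forall x \near w^', f x = 0.
  (* The same segment, run from [z] back to [w], would carry the vanishing of [f] to the region
     where it has no zero. *)
  apply: meromorphic_segment f0 => t /andP[t0 t1]; apply: fm.
  rewrite (_ : z + _ = w + (1 - t)%:C * (z - w)); last by rewrite rmorphB rmorph1; ring.
  by apply: wz; rewrite subr_ge0 t1 gerBl.
have fw : \forall x \near w^', f x != 0.
  by apply: near_dnbhs_near; move: we; apply: filterS => x; exact: H.
by case: (near_eq0_neq0 f0w fw).
Qed.

Lemma locally_constant f a (c : C) : (forall z, analytic_at f z) ->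
  (\forall x \near a^', f x = c) -> forall z, f z = c.
Proof.
move=> fa fc z; have fm x : meromorphic_at (fun x => f x + - c) x.
  apply: (@meromorphic_atD C (@cvg_half_complex R) f (fun=> - c)); last exact: meromorphic_at_cst.
  exact/removable_at_meromorphic/analytic_at_removable.
have f0 : \forall x \near a^', f x + - c = 0.
  by move: fc; apply: filterS => x ->; rewrite subrr.
have fz := meromorphic_eq0 z fm f0.
have c1 : f x @[x --> z^'] --> f z.
  by apply: cvg_trans (analytic_at_continuous (fa z)); apply: cvg_app; exact: nbhs_dnbhs.
apply: (cvg_unique _ c1); first exact: norm_hausdorff.
by apply: cvg_near_cst; move: fz; apply: filterS => x /eqP; rewrite subr_eq0 => /eqP.
Qed.

(* The maximum of |f| on the sphere is attained, either at infinity or in a large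
   compact set, and f is constant near a point where it is attained. *)
Lemma analytic_sphere_constant f g z : (forall z, analytic_at f z) ->
    cvg_pseries g -> (\forall u \near (0 : C)^', f u^-1 = g u) ->
  f z = f 0.
Proof.
move=> fa gs fg.
suff [a [c fc]] : exists a c, \forall x \near a^', f x = c.
  by rewrite !(locally_constant fa fc).
have [fle|/existsNP[z0 /negP]] := pselect (forall z, `|f z| <= `|g 0|).
  have gmax : \forall u \near (0 : C), `|g u| <= `|g 0|.
    move/near_dnbhsP: fg => [e e0 H]; apply/nbhs_normP; exists e => //= u /=.
    rewrite sub0r normrN => ue; have [->//|u0] := eqVneq u 0.
    by rewrite -H // subr0.
  have gc := near_dnbhs_near (local_max_constant gs gmax).
  exists 1, (g 0).
  have fm x : meromorphic_at (fun x => f x + - g 0) x.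
    apply: (@meromorphic_atD C (@cvg_half_complex R) f (fun=> - g 0)); last exact: meromorphic_at_cst.
    exact/removable_at_meromorphic/analytic_at_removable.
  have : \forall x \near (1 : C)^', f x + - g 0 = 0.
    apply: meromorphic_eq0_infty => //.
    by move: fg gc; apply: filterS2 => u -> ->; rewrite subrr.
  by apply: filterS => x /eqP; rewrite subr_eq0 => /eqP.
rewrite -modulus_le -ltNge => gf0.
have glt : \forall u \near (0 : C), modulus (g u) < modulus (f z0).
  have := continuous_modulus (cvg_pseries_cvg0 gs).
  by move/(@cvgr_lt R C (nbhs (0 : C))); exact.
have [e e0 He] : exists2 e : R, 0 < e & forall u : C, u != 0 -> `|u| < e%:C ->
    modulus (f u^-1) < modulus (f z0).
  have : \forall u \near (0 : C)^', modulus (f u^-1) < modulus (f z0).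
    by move: fg (near_dnbhs_near glt); apply: filterS2 => u ->.
  move=> /near_dnbhsP[e /gt0_complexE[-> e0] H].
  by exists (complex.Re e) => // u u0 ue; apply: H; rewrite ?subr0.
have [K Kc KP] := real_image_compact e^-1.
have out x : ~ K x -> modulus (f x) < modulus (f z0).
  move=> Kx; have ex : (e^-1)%:C < `|x|.
    rewrite real_ltNge ?normr_real //; first by apply/negP => /KP.
    by apply/complex_realP; exists e^-1.
  have x0 : 0 < `|x| by apply: lt_trans ex; rewrite ltcR invr_gt0.
  rewrite -[x]invrK; apply: He; first by rewrite invr_eq0 -normr_gt0.
  have ec : 0 < e%:C :> C by rewrite ltcR.
  by move: ex; rewrite normfV invf_plt ?posrE // fmorphV.
have Kz0 : K z0 by apply: contrapT => /out; rewrite ltxx.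
have fmc : continuous (fun x : C => modulus (f x)).
  by move=> x; apply: continuous_modulus; exact: analytic_at_continuous.
have [a _ amax] := compact_EVT_max (ex_intro _ z0 Kz0) Kc (continuous_subspaceT fmc).
have fmax x : modulus (f x) <= modulus (f a).
  have [Kx|Kx] := pselect (K x); first by apply: amax; rewrite inE.
  apply: le_trans (ltW (out x Kx)) _; apply: amax; by rewrite inE.
have [h hs fh] := fa a; exists a, (f a); apply/near_dnbhs_shift.
have ha : h 0 = f a by rewrite -(nbhs_singleton fh) addr0.
have hmax : \forall k \near (0 : C), `|h k| <= `|h 0|.
  by move: fh; apply: filterS => k <-; rewrite ha -modulus_le.
have := near_dnbhs_near (local_max_constant hs hmax).
by move: (near_dnbhs_near fh); apply: filterS2 => k -> ->.
Qed.

End RiemannSphere.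

Section SphereChart.
Variable C : numFieldType.
Hypothesis cvg_half : (fun n => (2^-1 : C) ^+ n) @ \oo --> (0 : C).
Implicit Types (f g : C -> C) (z : C).

Lemma near_neq0 z : \forall x \near z^', x != 0.
Proof.
have [->|z0] := eqVneq z 0; first exact: nbhs_dnbhs_neq.
apply: near_dnbhs_near; apply/nbhs_normP; exists `|z| => /=; first by rewrite normr_gt0.
by move=> x /=; apply: contraTneq => ->; rewrite subr0 ltxx.
Qed.

Lemma removable_atV_id z : z != 0 -> removable_at (fun x : C => x^-1) z.
Proof.
move=> z0; exists (fun h => (z + h)^-1); last by near=> h.
apply: (cvg_pseriesV cvg_half); last by rewrite addr0.
by apply: cvg_pseriesD; [exact: cvg_pseries_cst|exact: cvg_pseries_id].
Unshelve. all: by end_near. Qed.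

Lemma cvg_infty_chart N g (u : C) : u != 0 -> g y @[y --> u] --> g u ->
  (x ^+ N * g x^-1) @[x --> (u^-1)^'] --> u^-1 ^+ N * g u.
Proof.
move=> u0 gu; have cV : x^-1 @[x --> u^-1] --> u.
  have : x^-1 @[x --> u^-1] --> u^-1^-1.
    by apply: (@cvgV _ _ (nbhs u^-1)); [rewrite invr_eq0|exact: cvg_id].
  by rewrite invrK.
have cX : x ^+ N @[x --> u^-1] --> u^-1 ^+ N.
  have := analytic_at_continuous (analytic_at_horner ('X^N) (u^-1 : C)).
  by rewrite hornerXn; under eq_fun do rewrite hornerXn.
have cG : g x^-1 @[x --> u^-1] --> g u by exact: (cvg_comp _ _ cV gu).
have cM : x ^+ N * g x^-1 @[x --> u^-1] --> u^-1 ^+ N * g u.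
  exact: (@cvgM _ _ (nbhs u^-1) _ _ _ _ _ cX cG).
by apply: cvg_trans cM; apply: cvg_app; exact: nbhs_dnbhs.
Qed.

Lemma cvg_pseries_continuous g : cvg_pseries g ->
  \forall x \near (0 : C)^', g y @[y --> x] --> g x.
Proof. by case=> c /psum_to_continuous/near_dnbhs_near. Qed.

End SphereChart.

(** * Rationality of meromorphic functions on the sphere *)

Section Rationality.
Local Open Scope complex_scope.
Variable R : realType.
Local Notation C := (R[i] : numFieldType).
Implicit Types (f g : C -> C) (z a b : C) (p d : {poly R[i]}).

Let cvg_half := @cvg_half_complex R.

(* (f - f(0)) / x has again only removable singularities in the plane, and its
   pole at infinity has smaller order. *)
Lemma removable_sphere_polynomial N f g : (forall z, removable_at f z) ->
    cvg_pseries g ->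
    (\forall u \near (0 : C)^', \forall x \near (u^-1 : C)^', f x = x ^+ N * g x^-1) ->
  exists p, forall z, \forall x \near z^', f x = p.[x].
Proof.
elim: N f g => [|N IH] f g fr gs fg.
  have [F Fa Ff] := removable_extension fr.
  have Fg : \forall u \near (0 : C)^', F u^-1 = g u.
    move: fg (cvg_pseries_continuous gs) (near_neq0 (0 : C)); apply: filterS3 => u fu gu u0.
    have := @cvg_infty_chart C 0 g u u0 gu; rewrite expr0 mul1r => c1.
    apply: (cvg_unique _ _ c1); first exact: norm_hausdorff.
    have c2 : F x @[x --> (u^-1 : C)^'] --> F u^-1.
      apply: cvg_trans (analytic_at_continuous (Fa u^-1)).
      by apply: cvg_app; exact: nbhs_dnbhs.
    apply: cvg_trans c2; apply: near_eq_cvg.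
    by move: fu (Ff u^-1); apply: filterS2 => x <- ->.
  exists (F 0)%:P => z; have := Ff z; apply: filterS => x <-.
  by rewrite hornerC; exact: analytic_sphere_constant gs Fg.
have [F Fa Ff] := removable_extension fr; pose c := F 0.
have fcr z : removable_at (fun x => f x + - c) z.
  apply: (@removable_atD C f (fun=> - c) z (fr z)).
  by exists (fun=> - c); [exact: cvg_pseries_cst|near=> h].
have [z|||p pE] := IH (fun x => (f x + - c) * x^-1) (fun u => g u + - c * u ^+ N.+1).
- have [->|z0] := eqVneq z 0; last by apply: (removable_atM cvg_half) => //; exact: removable_atV_id.
  have [h hs Fh] := Fa 0.
  have h0 : h 0 = c by rewrite -(nbhs_singleton Fh) addr0.
  have [a ha] := cvg_pseriesD hs (cvg_pseries_cst (- c)).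
  have a0 : a 0%N = 0 by rewrite -(psum_at0 ha) h0 subrr.
  exists (fun x => if x == 0 then a 1%N else (h x + - c) / x).
    by exists (fun k => a k.+1); exact: psum_to_shift.
  move: (near_dnbhs_near Fh) (Ff 0) (near_neq0 (0 : C)); apply: filterS3 => x.
  by rewrite !add0r => Fx fx x0; rewrite (negbTE x0) -fx Fx.
- apply: (@cvg_pseriesD C g (fun u => - c * u ^+ N.+1) gs).
  apply: (@cvg_pseriesM C cvg_half (fun=> - c) (fun u => u ^+ N.+1)).
    exact: cvg_pseries_cst.
  exact: (@cvg_pseriesX C cvg_half id N.+1 (cvg_pseries_id C)).
- move: fg; apply: filterS => u; move: (near_neq0 u^-1); apply: filterS2 => x x0 ->.
  rewrite mulrDr mulrDl exprS; congr (_ + _); first by rewrite mulrC !mulrA mulVf ?mul1r.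
  by rewrite mulrCA exprVn exprS invfM [_ * (x^-1 * _)]mulrC -mulrA mulVf ?mulr1 // expf_neq0.
exists (c%:P + p * 'X) => z; move: (pE z) (near_neq0 z); apply: filterS2 => x px x0.
by rewrite !hornerE -px divfK // addrC subrK.
Unshelve. all: by end_near. Qed.

(** Growth of a polynomial at infinity, in the form required of [f]. The exponent [size d] exceeds
    the degree by one, which is harmless: only an upper bound on the order of the pole at infinity
    is wanted. *)
Lemma horner_rev_poly d (x : R[i]) : x != 0 ->
  d.[x] = x ^+ size d * (\sum_(i < size d) d`_i *: 'X^(size d - i)).[x^-1].
Proof.
move=> x0; rewrite horner_coef horner_sum mulr_sumr; apply: eq_bigr => i _.
rewrite hornerZ hornerXn exprVn mulrCA; congr (_ * _).
by rewrite -{2}(subnK (ltnW (ltn_ord i))) exprD mulrAC mulfV ?mul1r // expf_neq0.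
Qed.

(** The behaviour at infinity confines the poles to a compact set. Every point has a neighbourhood
    in which it alone can be a pole, so a finite subcover leaves finitely many candidates; [d] is
    the product of the linear factors that cancel them. *)
Lemma meromorphic_sphere_rational N f g : (forall z, meromorphic_at f z) ->
    cvg_pseries g ->
    (\forall u \near (0 : C)^', \forall x \near (u^-1 : C)^', f x = x ^+ N * g x^-1) ->
  exists d p, d != 0 /\ forall z, \forall x \near z^', d.[x] * f x = p.[x].
Proof.
move=> fm gs fg.
have [e' /gt0_complexE[-> e0] He] : exists2 e : C, 0 < e &
    forall z, e^-1 < `|z| -> removable_at f z.
  have : \forall u \near (0 : C)^', removable_at f u^-1.
    move: fg (cvg_pseries_continuous gs) (near_neq0 (0 : C)); apply: filterS3 => u fu gu u0.
    apply: (cvg_removable cvg_half (fm _) (l := u^-1 ^+ N * g u)).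
    have c1 := @cvg_infty_chart C N g u u0 gu; apply: (cvg_trans _ c1); apply: near_eq_cvg.
    by move: fu; apply: filterS => x ->.
  exact: (@near_infty_inv C (removable_at f)).
move: (complex.Re e') e0 He => e e0 He.
have [K Kc KP] := real_image_compact e^-1.
have out z : ~ K z -> removable_at f z.
  move=> Kz; apply: He; rewrite -fmorphV real_ltNge ?normr_real //.
    by apply/negP => /KP.
  by apply/complex_realP; exists e^-1.
have /choice[m mP] : forall z, exists m : nat, removable_at (fun x => (x - z) ^+ m * f x) z.
  move=> z; have [m [h [hs fh]]] := fm z; exists m, h => //.
  by move: fh; apply: filterS => k; rewrite addrAC subrr add0r.
pose U z := [set y | y != z -> removable_at f y]°.
have Uz z : U z z by exact: (near_punctured_removable cvg_half z fm).
have : cover_compact K by rewrite -compact_cover.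
move=> /(_ C K U (fun z _ => @open_interior _ _)) [].
  by move=> z Kz; exists z.
move=> D _ DK.
have {D DK}[s sK] : exists s : seq C, forall z, K z -> exists2 w, w \in s & U w z.
  by exists (finmap.enum_fset D) => z /DK[w wD Uwz]; exists w.
pose d : {poly R[i]} := \prod_(z <- s) ('X - z%:P) ^+ m z.
have d0 : d != 0.
  by apply: monic_neq0; apply: monic_prod => z _; apply: monic_exp; exact: monicXsubC.
have df z : removable_at (fun x => d.[x] * f x) z.
  have [fz|fz] := pselect (removable_at f z).
    by apply: (removable_atM cvg_half) => //; exact: removable_at_horner.
  have Kz : K z by apply: contrapT => /out.
  have [w ws Uwz] := sK z Kz.
  (* A pole lying in [U w] can only be its centre [w], hence it belongs to the finite list. *)
  have zw : z = w.
    by apply/eqP; apply/negPn/negP => zw; apply: fz; exact: (interior_subset Uwz).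
  have zs : z \in s by rewrite zw.
  apply: removable_at_ext (removable_atM cvg_half (mP z)
    (removable_at_horner (\prod_(y <- rem z s) ('X - y%:P) ^+ m y) z)).
  near=> x; rewrite /d (big_rem z zs) /= hornerM horner_exp hornerXsubC; ring.
pose d' : {poly R[i]} := \sum_(i < size d) d`_i *: 'X^(size d - i).
have [||p pE] := @removable_sphere_polynomial (size d + N) (fun x => d.[x] * f x)
    (fun u => d'.[u] * g u) df.
- exact: (@cvg_pseriesM C cvg_half (fun u => d'.[u]) g (cvg_pseries_horner d') gs).
- move: fg; apply: filterS => u; move: (near_neq0 u^-1); apply: filterS2 => x x0 ->.
  by rewrite (horner_rev_poly d x0) -/d' exprD mulrACA.
by exists d, p.
Unshelve. all: by end_near. Qed.

End Rationality.

(** * Reducibility *)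

Section Scaling.
Variable K : fieldType.

Lemma scaler_solve m n (a : K) (X Y : 'M[K]_(m, n)) : a != 0 -> X = a *: Y ->
  Y = a^-1 *: X.
Proof. by move=> a0 ->; rewrite scalerA mulVf ?scale1r. Qed.

Lemma clear_denominators m n p (s e d : K) (X : 'M[K]_(m, n)) (A : 'M[K]_(n, p))
    (B : 'M[K]_m) (Y : 'M[K]_(m, p)) : s != 0 -> e != 0 -> d != 0 ->
  (s^-1 *: X) *m A = (e^-1 *: B) *m (d^-1 *: Y) ->
  (e * d) *: (X *m A) = (s *: B) *m Y.
Proof.
move=> s0 e0 d0 /(congr1 (fun Z => (s * e * d) *: Z)).
rewrite -!scalemxAl -!scalemxAr !scalerA => E.
have <- : s * e * d * s^-1 = e * d by field.
by rewrite E; congr (_ *: _); field; apply/andP.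
Qed.

Lemma row_free_usubmx r k (F : 'M[K]_(r + k)) : F \in unitmx -> row_free (usubmx F).
Proof.
move=> Fu; apply/row_freeP; exists (invmx F *m col_mx 1%:M 0).
by rewrite mulmxA mul_usub_mx mulmxV // scalar_mx_block /block_mx col_mxKu mul_row_col mulmx1 mulmx0 addr0.
Qed.

Lemma row_free_dsubmx r k (F : 'M[K]_(r + k)) : F \in unitmx -> row_free (dsubmx F).
Proof.
move=> Fu; apply/row_freeP; exists (invmx F *m col_mx 0 1%:M).
by rewrite mulmxA mul_dsub_mx mulmxV // scalar_mx_block /block_mx col_mxKd mul_row_col mulmx1 mulmx0 add0r.
Qed.

(** In the rank factorization of [L] the middle factor is [(1 0)], so [L] is the top part of the row
    base multiplied by the column base; the remaining rows of the row base complete it. *)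
Lemma row_free_complete m k (L : 'M[K]_(m, m + k)) : row_free L ->
  exists2 F : 'M[K]_(m + k), F \in unitmx & usubmx F = L.
Proof.
move=> Lf; exists (block_mx (col_ebase L) 0 0 1%:M *m row_ebase L).
  rewrite unitmx_mul row_ebase_unit andbT unitmxE det_lblock det1 mulr1.
  by rewrite -unitmxE col_ebase_unit.
rewrite -mul_usub_mx /block_mx col_mxKu -[RHS]mulmx_ebase; congr (_ *m _).
have -> : \rank L = m by apply/eqP.
by rewrite pid_mx_row mul_mx_row mulmx1 mulmx0.
Qed.

End Scaling.

Section Fractions.
Variables (D : idomainType) (K : fieldType) (phi : {rmorphism D -> K}).
Hypothesis phi_eq0 : forall a, (phi a == 0) = (a == 0).
Hypothesis phi_frac : forall x, exists a b, b != 0 /\ x = phi a / phi b.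

Lemma common_denominator m n (L : 'M[K]_(m, n)) :
  exists2 d, d != 0 & exists P, map_mx phi P = phi d *: L.
Proof.
have /choice[num /choice[den nd]] : forall x : 'I_m * 'I_n, exists a b,
    b != 0 /\ L x.1 x.2 = phi a / phi b by move=> x; exact: phi_frac.
exists (\prod_x den x); first by apply/prodf_neq0 => x _; case: (nd x).
exists (\matrix_(i, j) (num (i, j) * \prod_(x | x != (i, j)) den x)).
apply/matrixP => i j; rewrite !mxE; have [den0 /= ->] := nd (i, j).
rewrite [\prod_x den x](bigD1 (i, j)) //= !rmorphM /=.
have b0 : phi (den (i, j)) != 0 by rewrite phi_eq0.
by rewrite [RHS]mulrC mulrA divfK.
Qed.

Variables (s : D -> D) (sK : K -> K).
Hypothesis s_neq0 : forall a, a != 0 -> s a != 0.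
Hypothesis sK_div : forall a b, b != 0 -> sK (phi a / phi b) = phi (s a) / phi (s b).

(* The rows of P span a subspace of rank m that is stable under the action
   X |-> s(X) A; denominators are cleared by [e]. *)
Definition invariant_lattice n (A : 'M[D]_n) : Prop :=
  exists m (f : 'I_m -> 'I_n) (e : D) (P : 'M[D]_(m, n)) (B : 'M[D]_m),
    [/\ (0 < m < n)%N, e != 0, \det (colsub f P) != 0 &
        e *: (map_mx s P *m A) = B *m P].

Lemma map_phi_inj m n : injective (@map_mx _ _ phi m n).
Proof.
move=> X Y /matrixP XY; apply/matrixP => i j; have /eqP := XY i j.
by rewrite !mxE -subr_eq0 -rmorphB phi_eq0 subr_eq0 => /eqP.
Qed.

Lemma sK_scaled m n (d : D) (P : 'M[D]_(m, n)) : d != 0 ->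
  map_mx sK ((phi d)^-1 *: map_mx phi P) = (phi (s d))^-1 *: map_mx phi (map_mx s P).
Proof. by move=> d0; apply/matrixP => i j; rewrite !mxE mulrC sK_div // mulrC. Qed.

Lemma lattice_of_subspace m n (A : 'M[D]_n) (L : 'M[K]_(m, n)) (b : 'M[K]_m) :
    (0 < m < n)%N -> row_free L -> map_mx sK L *m map_mx phi A = b *m L ->
  invariant_lattice A.
Proof.
move=> mn Lf LA; have [f Lu] := row_free_colsub Lf.
have [d d0 [P PE]] := common_denominator L.
have [e e0 [B BE]] := common_denominator b.
have td0 : phi d != 0 by rewrite phi_eq0.
have te0 : phi e != 0 by rewrite phi_eq0.
have tsd0 : phi (s d) != 0 by rewrite phi_eq0 s_neq0.
have LE := scaler_solve td0 PE; have bE := scaler_solve te0 BE.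
exists m, f, (e * d), P, (s d *: B); split => //.
- by rewrite mulf_neq0.
- rewrite -phi_eq0 -det_map_mx map_mxsub PE.
  have -> : colsub f (phi d *: L) = phi d *: colsub f L.
    by apply/matrixP => i j; rewrite !mxE.
  by rewrite detZ mulf_neq0 ?expf_neq0 // -unitfE -unitmxE.
apply: map_phi_inj; move: LA; rewrite {1}LE sK_scaled // {1}LE bE => LA.
rewrite map_mxZ !map_mxM map_mxZ rmorphM.
exact: clear_denominators LA.
Qed.

(** With [G] the gauge transform, [map_mx sK F *m map_mx phi A = G *m F]. A zero lower left block
    makes the span of the last [k] rows of [F] stable, a zero upper right block that of the first
    [r] rows. *)
Lemma gauge_lattice n (A : 'M[D]_n) (F : 'M[K]_n) : F \in unitmx ->
  block_triangular (fun i j => (map_mx sK F *m map_mx phi A *m invmx F) i j = 0) ->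
  invariant_lattice A.
Proof.
move=> Fu [r /andP[r0 rn]].
have [k nE] : exists k, n = (r + k)%N by exists (n - r)%N; rewrite subnKC // ltnW.
subst n; have k0 : (0 < k)%N by rewrite -(ltn_add2l r) addn0.
move GE : (_ *m invmx F) => G H.
have GF : map_mx sK F *m map_mx phi A = G *m F by rewrite -GE mulmxKV.
move: GF; rewrite -[G]submxK -{1 2}[F]vsubmxK map_col_mx mul_col_mx mul_block_col.
move=> /eq_col_mx[GU GD]; case: H => H.
  have dl0 : dlsubmx G = 0.
    by apply/matrixP => i j; rewrite !mxE; apply: H => //=; rewrite leq_addr.
  move: GD; rewrite dl0 mul0mx add0r => GD.
  apply: lattice_of_subspace GD; first by rewrite k0 -{1}(add0n k) ltn_add2r.
  exact: row_free_dsubmx.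
have ur0 : ursubmx G = 0.
  by apply/matrixP => i j; rewrite !mxE; apply: H => //=; rewrite leq_addr.
move: GU; rewrite ur0 mul0mx addr0 => GU.
apply: lattice_of_subspace GU; first by rewrite r0.
exact: row_free_usubmx.
Qed.

(** The basis [P] is completed to an invertible [F]; stability says that the first [m] rows of the
    gauge transform are [(b 0)]. Writing entries of [P] with denominator 1 relates [sK] to [s],
    whence the condition [s 1 = 1]. *)
Lemma lattice_gauge n (A : 'M[D]_n) : s 1 = 1 -> invariant_lattice A ->
  exists2 F : 'M[K]_n, F \in unitmx &
  block_triangular (fun i j => (map_mx sK F *m map_mx phi A *m invmx F) i j = 0).
Proof.
move=> s1 [m [f [e [P [B [/andP[m0 mn] e0 Pf EP]]]]]].
have [k nE] : exists k, n = (m + k)%N by exists (n - m)%N; rewrite subnKC // ltnW.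
subst n; pose L := map_mx phi P.
have Lf : row_free L.
  apply: (@colsub_unit_free _ _ _ _ f).
  by rewrite unitmxE unitfE -map_mxsub det_map_mx phi_eq0.
have [F Fu FL] := row_free_complete Lf.
pose b := (phi e)^-1 *: map_mx phi B.
have LA : map_mx sK L *m map_mx phi A = b *m L.
  have -> : map_mx sK L = map_mx phi (map_mx s P).
    have := sK_scaled P (oner_neq0 D).
    by rewrite s1 rmorph1 invr1 !scale1r.
  rewrite -map_mxM /b -scalemxAl /L -map_mxM -EP map_mxZ scalerA mulVf ?phi_eq0 //.
  by rewrite scale1r.
exists F => //; exists m; first by rewrite m0.
right=> i j im mj; move GE : (_ *m invmx F) => G.
have GU : usubmx G = row_mx b 0.
  rewrite -GE -!mul_usub_mx -map_usubmx FL LA -FL -mulmxA mul_usub_mx mulmxV //.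
  by rewrite scalar_mx_block /block_mx col_mxKu mul_mx_row mulmx1 mulmx0.
have jm : (j - m < k)%N by rewrite ltn_subLR.
have jE : j = rshift m (Ordinal jm) by apply/val_inj; rewrite /= subnKC.
have -> : G i j = (usubmx G) (Ordinal im) j.
  by rewrite [RHS]mxE; congr (G _ _); apply/val_inj.
by rewrite GU jE row_mxEr mxE.
Qed.

End Fractions.

Section Reducible.
Variables (C : numFieldType) (q : C).
Hypothesis q0 : q != 0.
Local Notation qshift := (fun p : {poly C} => p \Po (q *: 'X)).

Lemma qshift_neq0 (p : {poly C}) : p != 0 -> qshift p != 0.
Proof.
move=> p0; rewrite -size_poly_eq0 size_comp_poly2 ?size_poly_eq0 //.
by rewrite size_scale // size_polyX.
Qed.

Lemma tofrac_frac (x : {fraction {poly C}}) :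
  exists a b, b != 0 /\ x = tofrac a / tofrac b.
Proof.
exists (frac (repr x)).1, (frac (repr x)).2; split; first exact: denom_ratioP.
exact: frac_reprE.
Qed.

(** From here on only polynomial matrices occur, and these can be evaluated at complex numbers. *)
Lemma reducibleP n (A : 'M[{poly C}]_n) :
  reducible q A <-> invariant_lattice qshift A.
Proof.
split.
  case=> F Fu; rewrite /gauge_frac.
  apply: (@gauge_lattice _ _ (@tofrac {poly C}) (@tofrac_eq0 _) tofrac_frac _ _ qshift_neq0) => //.
  by move=> a b b0; exact: sigma_frac_div.
apply: (@lattice_gauge _ _ (@tofrac {poly C}) (@tofrac_eq0 _)).
  by move=> a b b0; exact: sigma_frac_div.
by rewrite comp_polyC.
Qed.

End Reducible.

(** * Selecting rows and columns *)

Section Selection.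
Variable K : fieldType.

Lemma unitmx_det n (X : 'M[K]_n) : (X \in unitmx) = (\det X != 0).
Proof. by rewrite unitmxE unitfE. Qed.

Lemma det0_nunit n (X : 'M[K]_n) : \det X = 0 -> X \in unitmx -> False.
Proof. by rewrite unitmx_det => -> /eqP. Qed.

Lemma sum_codom m n (J : 'I_m -> 'I_n) (F : 'I_n -> K) : injective J ->
  (forall i, i \notin codom J -> F i = 0) -> \sum_l F (J l) = \sum_i F i.
Proof.
move=> Ji F0; rewrite [RHS](bigID (mem (codom J))) /= [X in _ + X]big1 //.
rewrite addr0 -big_uniq /=; last by rewrite map_inj_uniq ?enum_uniq.
by rewrite big_map big_enum.
Qed.

Lemma colsub_rowsub_mul m n p l (J : 'I_m -> 'I_n) (N : 'M[K]_(p, n)) (X : 'M[K]_(n, l)) :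
    injective J -> (forall k i, i \notin codom J -> N k i = 0) ->
  colsub J N *m rowsub J X = N *m X.
Proof.
move=> Ji N0; apply/matrixP => k j; rewrite !mxE.
under eq_bigr do rewrite !mxE.
by rewrite (sum_codom (F := fun i => N k i * X i j)) // => i Hi; rewrite N0 ?mul0r.
Qed.

Lemma colsub_scale m n p (f : 'I_p -> 'I_n) (c : K) (X : 'M[K]_(m, n)) :
  colsub f (c *: X) = c *: colsub f X.
Proof. by apply/matrixP => i j; rewrite !mxE. Qed.

Lemma row_free_mul_unit m n (X : 'M[K]_(m, n)) (Y : 'M[K]_n) :
  row_free X -> Y \in unitmx -> row_free (X *m Y).
Proof. by move=> Xf Yu; rewrite /row_free mxrankMfree // row_free_unit. Qed.

Lemma row_free_rowsub m n (a : 'I_m -> 'I_n) (X : 'M[K]_n) : injective a ->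
  X \in unitmx -> row_free (rowsub a X).
Proof.
move=> ai Xu; rewrite -[X]mul1mx -mul_rowsub_mx; apply: row_free_mul_unit Xu.
apply/row_freeP; exists (colsub a 1%:M); apply/matrixP => i j.
by rewrite mulmx_colsub mulmx1 !mxE (inj_eq ai).
Qed.

Lemma colsub_unit_of_zero_columns m n (J : 'I_m -> 'I_n) (N : 'M[K]_(m, n)) : injective J ->
  (forall k i, i \notin codom J -> N k i = 0) -> row_free N -> colsub J N \in unitmx.
Proof.
move=> Ji N0 Nf; rewrite -row_free_unit -row_leq_rank.
have NE : N = colsub J N *m rowsub J 1%:M by rewrite colsub_rowsub_mul // mulmx1.
by rewrite -row_leq_rank {1}NE in Nf; exact: leq_trans Nf (mxrankM_maxl _ _).
Qed.

End Selection.

(** The permutation enumerates the image of [J] first, then the other indices. Indices of ['I_m] and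
    ['I_n] are compared as naturals, which avoids a cast. *)
Lemma extend_inj_perm m n (J : 'I_m -> 'I_n) : injective J ->
  exists s : 'S_n, forall (l : 'I_m) (i : 'I_n), i = l :> nat -> s i = J l.
Proof.
move=> Ji; pose w := codom J ++ [seq i <- enum 'I_n | i \notin codom J].
have wu : uniq w.
  rewrite cat_uniq map_inj_uniq ?enum_uniq // filter_uniq ?enum_uniq //= andbT.
  by apply/hasPn => i; rewrite mem_filter => /andP[].
have sw : size w = n.
  rewrite -[RHS]card_ord cardE; apply/eqP; rewrite eqn_leq !uniq_leq_size ?enum_uniq //.
    by move=> i _; rewrite mem_cat mem_filter mem_enum andbT; case: (i \in codom J).
  by move=> i _; rewrite mem_enum.
have gi : injective (fun i : 'I_n => nth i w i).
  move=> i j; rewrite (set_nth_default j) ?sw // => /eqP.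
  by rewrite nth_uniq ?sw // => /eqP/val_inj.
exists (perm gi) => l i il; rewrite permE nth_cat size_codom card_ord il ltn_ord.
rewrite (nth_map l) ?size_enum_ord //; congr J; apply/val_inj.
by rewrite /= nth_enum_ord.
Qed.

Section PolynomialMatrices.
Variable C : numFieldType.
Hypothesis cvg_half : (fun n => (2^-1 : C) ^+ n) @ \oo --> (0 : C).

Definition mx_horner m n (P : 'M[{poly C}]_(m, n)) (x : C) : 'M[C]_(m, n) :=
  map_mx (horner_eval x) P.

Lemma mx_hornerE m n (P : 'M[{poly C}]_(m, n)) x i j : mx_horner P x i j = (P i j).[x].
Proof. by rewrite mxE. Qed.

Lemma mx_hornerM m n p (P : 'M[{poly C}]_(m, n)) (Q : 'M[{poly C}]_(n, p)) x :
  mx_horner (P *m Q) x = mx_horner P x *m mx_horner Q x.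
Proof. exact: map_mxM. Qed.

Lemma mx_hornerZ m n (e : {poly C}) (P : 'M[{poly C}]_(m, n)) x :
  mx_horner (e *: P) x = e.[x] *: mx_horner P x.
Proof. exact: map_mxZ. Qed.

Lemma mx_horner_colsub m n p (f : 'I_p -> 'I_n) (P : 'M[{poly C}]_(m, n)) x :
  mx_horner (colsub f P) x = colsub f (mx_horner P x).
Proof. exact: map_mxsub. Qed.

Lemma mx_horner_qshift q m n (P : 'M[{poly C}]_(m, n)) x :
  mx_horner (map_mx (fun p : {poly C} => p \Po (q *: 'X)) P) x = mx_horner P (q * x).
Proof. by apply/matrixP => i j; rewrite !mxE /horner_eval horner_comp hornerZ hornerX. Qed.

Lemma near_horner_neq0 (p : {poly C}) z : p != 0 -> \forall x \near z^', p.[x] != 0.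
Proof.
move=> p0; have [k [r rz pE]] := multiplicity_XsubC p z.
have rz0 : r.[z] != 0 by move: rz; rewrite p0.
have rn : \forall x \near z, r.[x] != 0.
  apply: (cvgr_neq0 _ (analytic_at_continuous (analytic_at_horner r z))).
  exact: rz0.
have /near_dnbhsP := near_dnbhs_near rn => -[e e0 H].
apply/near_dnbhsP; exists e => // x xz xe.
rewrite pE hornerM horner_exp hornerXsubC mulf_neq0 ?H //.
by rewrite expf_neq0 // subr_eq0.
Qed.

Lemma near_poly_eq (p r : {poly C}) z : (\forall x \near z^', p.[x] = r.[x]) -> p = r.
Proof.
move=> pr; apply/eqP; rewrite -subr_eq0; apply: contraT => /(near_horner_neq0 z) H.
have [x [px]] := filter_ex (filterI pr H).
by rewrite !hornerE px subrr eqxx.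
Qed.

Lemma near_mx_horner_eq m n (P Q : 'M[{poly C}]_(m, n)) z :
  (\forall x \near z^', mx_horner P x = mx_horner Q x) -> P = Q.
Proof.
move=> PQ; apply/matrixP => i j; apply: (@near_poly_eq _ _ z).
by move: PQ; apply: filterS => x /matrixP/(_ i j); rewrite !mx_hornerE.
Qed.

Lemma meromorphic_mx_horner m n (P : 'M[{poly C}]_(m, n)) z :
  meromorphic_mx (mx_horner P) z.
Proof. by move=> i j; under eq_fun do rewrite mx_hornerE; exact: meromorphic_at_horner. Qed.

Lemma meromorphic_at_horner_inv (p : {poly C}) : meromorphic_at (fun u => p.[u^-1]) 0.
Proof.
elim/poly_ind: p => [|p c IH].
  by under eq_fun do rewrite horner0; exact: meromorphic_at_cst.
under eq_fun do rewrite !hornerE.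
apply: (meromorphic_atD cvg_half); last exact: meromorphic_at_cst.
apply: (meromorphic_atM cvg_half) => //; apply: (meromorphic_atV cvg_half).
have := meromorphic_at_horner 'X (0 : C); apply: meromorphic_at_ext.
by near=> x; rewrite hornerX.
Unshelve. all: by end_near. Qed.

Lemma GL_pseries_unit n (F : C -> 'M[C]_n) : GL_pseries F ->
  \forall x \near (0 : C), F x \in unitmx.
Proof. by case=> _ [G _]; apply: filterS => x /mulmx1_unit[]. Qed.

Lemma mx_pseries_meromorphic n (F : C -> 'M[C]_n) : mx_pseries F -> meromorphic_mx F 0.
Proof.
move=> Fs i j; apply: (meromorphic_at_holo (Fs i j)).
by near=> h; rewrite add0r.
Unshelve. all: by end_near. Qed.

Lemma meromorphic_mx_ext m n (F G : C -> 'M[C]_(m, n)) z : (\forall x \near z^', F x = G x) ->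
  meromorphic_mx F z -> meromorphic_mx G z.
Proof.
move=> FG Fm i j; apply: meromorphic_at_ext (Fm i j).
by move: FG; apply: filterS => x ->.
Qed.

(** Needed because the zero block of [M] is a statement about its values, whereas meromorphic
    identities only hold off the point. *)
Lemma holomorphic_near0 (f : C -> C) (z : C) : derivable f z 1 ->
  (\forall x \near z^', f x = 0) -> f z = 0.
Proof.
move=> /derivable1_diffP/differentiable_continuous fc f0.
have c1 : f x @[x --> z^'] --> f z.
  by apply: cvg_trans fc; apply: cvg_app; exact: nbhs_dnbhs.
by apply: (cvg_unique _ c1); [exact: norm_hausdorff|exact: cvg_near_cst].
Qed.

End PolynomialMatrices.

(** * The connection matrix *)

Section Birkhoff.
Local Open Scope complex_scope.
Variable R : realType.
Local Notation C := (R[i] : numFieldType).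
Let cvg_half := @cvg_half_complex R.
Local Notation qshift q := (fun p : {poly C} => p \Po (q *: 'X)).

Lemma near_horner_inv_neq0 (p : {poly C}) : p != 0 ->
  \forall u \near (0 : C)^', p.[u^-1] != 0.
Proof.
move=> p0; have [p0'|//] := meromorphic_at_dichotomy (meromorphic_at_horner_inv cvg_half p).
have := @meromorphic_eq0_infty R (horner p) 1
  (fun z _ => meromorphic_at_horner p z) p0' (oner_neq0 C).
by move=> p1; case: (near_eq0_neq0 p1 (near_horner_neq0 1 p0)).
Qed.

Lemma near_unit n (F : C -> 'M[C]_n) (a b : C) : (forall z, meromorphic_mx F z) ->
  (\forall x \near a^', F x \in unitmx) -> \forall x \near b^', F x \in unitmx.
Proof.
move=> Fm Fu; have Fd z := meromorphic_at_det cvg_half (Fm z).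
have [F0|] := meromorphic_at_dichotomy (Fd b).
  have F0a := meromorphic_eq0 a Fd F0.
  have [x [xd xu]] := filter_ex (filterI F0a Fu).
  by case: (det0_nunit xd xu).
by apply: filterS => x; rewrite unitmx_det.
Qed.

Lemma near_unit_infty n (F : C -> 'M[C]_n) (z : C) :
    (forall z, z != 0 -> meromorphic_mx F z) ->
    (\forall u \near (0 : C)^', F u^-1 \in unitmx) -> z != 0 ->
  \forall x \near z^', F x \in unitmx.
Proof.
move=> Fm Fu z0; have Fd w (w0 : w != 0) := meromorphic_at_det cvg_half (Fm w w0).
have Fu' : \forall u \near (0 : C)^', \det (F u^-1) != 0.
  by move: Fu; apply: filterS => u; rewrite unitmx_det.
have := @meromorphic_neq0_infty R (fun x => \det (F x)) z Fd Fu' z0.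
by apply: filterS => x; rewrite unitmx_det.
Qed.

Variables (q : C) (n mu : nat) (A : 'M[{poly C}]_n).
Hypothesis q0 : q != 0.

(** Evaluating the lattice equation gives [N (q x) R = (B / e) N x] for [N = P M0], the input of
    [eigen_columns]. *)
Lemma lattice_columns_at_0 m (e : {poly C}) (P : 'M[{poly C}]_(m, n)) B
    (rho : 'rV[C]_n) (M0 : C -> 'M[C]_n) :
    e != 0 -> (forall z, \forall x \near z^', row_free (mx_horner P x)) ->
    e *: (map_mx (qshift q) P *m A) = B *m P ->
    (forall j, rho 0 j != 0) ->
    (forall i j, i != j -> ~ congruent_mod_qZ q (rho 0 i) (rho 0 j)) ->
    (forall z, meromorphic_mx M0 z) -> (\forall x \near (0 : C)^', M0 x \in unitmx) ->
    (\forall x \near (0 : C)^', M0 (q * x) *m diag_mx rho = mx_horner A x *m M0 x) ->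
  exists2 J : 'I_m -> 'I_n, injective J & forall k j, j \notin codom J ->
    forall z, \forall x \near z^', (mx_horner P x *m M0 x) k j = 0.
Proof.
move=> e0 Pf EP rho0 rhoq M0m M0u M0A.
pose N x := mx_horner P x *m M0 x.
have Nm z : meromorphic_mx N z.
  by apply: (meromorphic_mxM cvg_half) => //; exact: meromorphic_mx_horner.
have Nf : \forall x \near (0 : C)^', row_free (N x).
  by move: (Pf 0) M0u; apply: filterS2 => x; exact: row_free_mul_unit.
have [|J Ju J0] := @eigen_columns C cvg_half q m n rho N
    (fun x => e.[x]^-1 *: mx_horner B x) q0 rho0 rhoq (Nm 0) Nf.
  move: M0A (near_horner_neq0 0 e0); apply: filterS2 => x M0A ex.
  have := congr1 (fun X => mx_horner X x) EP.
  rewrite mx_hornerZ !mx_hornerM mx_horner_qshift => EPx.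
  rewrite /N -mulmxA M0A mulmxA -scalemxAl mulmxA -EPx -scalemxAl scalerA.
  by rewrite mulVf ?scale1r.
exists J.
  by have [x Jx] := filter_ex Ju; exact: colsub_unit_inj Jx.
(* [eigen_columns] only yields vanishing near 0; since [N] is meromorphic on the plane, it spreads
   to every point. *)
by move=> k j jJ z; apply: (meromorphic_eq0 z (fun w => Nm w k j)); exact: J0.
Qed.

(** In the coordinate [u = 1/x] the shift by [q] becomes the shift by [q^-1], under which non
    congruence is unchanged. The scalar [x ^ mu] moves to the other side as the factor [u ^ mu] of
    the coefficient matrix, leaving the constant diagonal matrix that [eigen_columns] expects. *)
Lemma lattice_columns_at_infty m (e : {poly C}) (P : 'M[{poly C}]_(m, n)) B
    (sigma : 'rV[C]_n) (Minf : C -> 'M[C]_n) f :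
    e != 0 -> \det (colsub f P) != 0 ->
    e *: (map_mx (qshift q) P *m A) = B *m P ->
    (forall j, sigma 0 j != 0) ->
    (forall i j, i != j -> ~ congruent_mod_qZ q (sigma 0 i) (sigma 0 j)) ->
    (forall z, z != 0 -> meromorphic_mx Minf z) ->
    meromorphic_mx (fun u => Minf u^-1) 0 ->
    (\forall u \near (0 : C)^', Minf u^-1 \in unitmx) ->
    (\forall u \near (0 : C)^', Minf (q * u^-1) *m (u^-1 ^+ mu *: diag_mx sigma)
       = mx_horner A u^-1 *m Minf u^-1) ->
  exists2 J : 'I_m -> 'I_n, injective J & forall k j, j \notin codom J ->
    forall z, z != 0 -> \forall x \near z^', (mx_horner P x *m Minf x) k j = 0.
Proof.
move=> e0 Pf EP sigma0 sigmaq Mm Mm0 Mu MA.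
pose N x := mx_horner P x *m Minf x.
have Nm z : z != 0 -> meromorphic_mx N z.
  move=> z0; apply: (meromorphic_mxM cvg_half); last exact: Mm.
  exact: meromorphic_mx_horner.
have Nm0 : meromorphic_mx (fun u => N u^-1) 0.
  apply: (meromorphic_mxM cvg_half) => // i j.
  by under eq_fun do rewrite mx_hornerE; exact: meromorphic_at_horner_inv.
have Nf : \forall u \near (0 : C)^', row_free (N u^-1).
  move: (near_horner_inv_neq0 Pf) Mu; apply: filterS2 => u Pu.
  apply: row_free_mul_unit; apply: (@colsub_unit_free _ _ _ _ f).
  rewrite unitmxE unitfE; move: Pu; rewrite -/(horner_eval u^-1 _) -det_map_mx.
  by rewrite map_mxsub.
have qV0 : q^-1 != 0 by rewrite invr_eq0.
have sigmaqV i j : i != j -> ~ congruent_mod_qZ q^-1 (sigma 0 i) (sigma 0 j).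
  by move=> ij [k sk]; apply: (sigmaq i j ij); exists (- k); rewrite sk exprz_inv.
have [|J Ju J0] := @eigen_columns C cvg_half q^-1 m n sigma (fun u => N u^-1)
    (fun u => (u ^+ mu / e.[u^-1]) *: mx_horner B u^-1) qV0 sigma0 sigmaqV Nm0 Nf.
  move: MA (near_horner_inv_neq0 e0) (near_neq0 (0 : C)); apply: filterS3 => u MA eu u0.
  have := congr1 (fun X => mx_horner X u^-1) EP.
  rewrite mx_hornerZ !mx_hornerM mx_horner_qshift => EPx.
  rewrite invfM invrK /N -mulmxA.
  have -> : Minf (q * u^-1) *m diag_mx sigma = u ^+ mu *: (mx_horner A u^-1 *m Minf u^-1).
    by rewrite -MA -scalemxAr scalerA -exprMn mulfV // expr1n scale1r.
  rewrite -scalemxAr !mulmxA -!scalemxAl -EPx -scalemxAl scalerA.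
  by rewrite divfK.
exists J.
  by have [x Jx] := filter_ex Ju; exact: colsub_unit_inj Jx.
move=> k j jJ z z0.
by apply: (@meromorphic_eq0_infty R (fun x => N x k j) z (fun w w0 => Nm w w0 k j)) => //; exact: J0.
Qed.

End Birkhoff.

(** * Pointwise matrix identities *)

Section MatrixIdentities.
Variable K : fieldType.

Lemma conj_diag_unit n (P : 'M[K]_n) (d : 'rV[K]_n) :
  P *m diag_mx d *m invmx P \in unitmx -> forall j, d 0 j != 0.
Proof.
rewrite !unitmx_mul => /andP[/andP[_ du] _] j; move: du.
by rewrite unitmx_det det_diag => /prodf_neq0; apply.
Qed.

(** The normalized basis depends only on the row space. Taking the columns [f] of [Y = X Z] shows
    that [X] and the minor of [Z] are invertible once that of [Y] is, and [X] cancels. *)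
Lemma minor_normalization m n (f : 'I_m -> 'I_n) (X : 'M[K]_m) (Y Z : 'M[K]_(m, n)) :
    Y = X *m Z -> colsub f Y \in unitmx ->
  invmx (colsub f Y) *m Y = invmx (colsub f Z) *m Z.
Proof.
move=> YE Yu; have YfE : colsub f Y = X *m colsub f Z by rewrite YE mulmx_colsub.
have /andP[_ Zu] : (X \in unitmx) && (colsub f Z \in unitmx).
  by rewrite -unitmx_mul -YfE.
apply: (canLR (mulKmx Yu)); rewrite YfE -!mulmxA [X in _ *m X]mulmxA.
by rewrite mulmxV // mul1mx.
Qed.

Lemma colsub_normalization m n (f : 'I_m -> 'I_n) (Y : 'M[K]_(m, n)) :
  colsub f Y \in unitmx -> colsub f (invmx (colsub f Y) *m Y) = 1%:M.
Proof. by move=> Yu; rewrite -mulmx_colsub mulVmx. Qed.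

Lemma rowsub_diag m n p (a : 'I_m -> 'I_n) (d : 'rV[K]_n) (X : 'M[K]_(n, p)) :
  rowsub a (diag_mx d *m X) = diag_mx (colsub a d) *m rowsub a X.
Proof. by apply/matrixP => i j; rewrite !mul_diag_mx !mxE. Qed.

(** The hypothesis reads [Mq^-1 A = diag(d) M^-1]: each row of [Mq^-1] is sent by [A] to a multiple
    of the same row of [M^-1]. After normalization the coefficient matrix is read off on the columns
    [f], where [L] is the identity. *)
Lemma normalized_rows_shift m n (a f : 'I_m -> 'I_n) (d : 'rV[K]_n) (M Mq A : 'M[K]_n) :
    M \in unitmx -> Mq \in unitmx -> Mq *m diag_mx d = A *m M ->
  let Y := rowsub a (invmx M) in let Yq := rowsub a (invmx Mq) in
  colsub f Y \in unitmx -> colsub f Yq \in unitmx ->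
  let L := invmx (colsub f Y) *m Y in let Lq := invmx (colsub f Yq) *m Yq in
  Lq *m A = colsub f (Lq *m A) *m L.
Proof.
move=> Mu Mqu MA Y Yq Yu Yqu L Lq.
have MAV : invmx Mq *m A = diag_mx d *m invmx M.
  apply: (canLR (mulKmx Mqu)); rewrite mulmxA MA -mulmxA mulmxV ?mulmx1 //.
have YA : Yq *m A = diag_mx (colsub a d) *m Y.
  by rewrite /Yq mul_rowsub_mx MAV rowsub_diag.
have LA : Lq *m A = invmx (colsub f Yq) *m diag_mx (colsub a d) *m colsub f Y *m L.
  by rewrite /Lq -mulmxA YA /L -!mulmxA mulKVmx.
rewrite LA -[in RHS]mulmx_colsub [colsub f L]colsub_normalization //.
by rewrite mulmx1.
Qed.

(** Since [X M0] is supported on the columns [a], multiplying it by [M0^-1 Mi] only involves the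
    rows [a] of the latter; its minor on [a] is invertible by rank and can be cancelled. *)
Lemma zero_entries m n (a : 'I_m -> 'I_n) (X : 'M[K]_(m, n)) (M0 Mi : 'M[K]_n) j :
    injective a -> row_free X -> M0 \in unitmx ->
    (forall k i, i \notin codom a -> (X *m M0) k i = 0) ->
    (forall k, (X *m Mi) k j = 0) ->
  forall l, (invmx M0 *m Mi) (a l) j = 0.
Proof.
move=> ai Xf M0u a0 j0 l; set M := invmx M0 *m Mi; set N := X *m M0 in a0.
have Nu : colsub a N \in unitmx.
  by apply: colsub_unit_of_zero_columns => //; exact: row_free_mul_unit.
have NM : colsub a N *m rowsub a M = X *m Mi.
  by rewrite colsub_rowsub_mul // /N /M -mulmxA mulKVmx.
have : rowsub a M = invmx (colsub a N) *m (X *m Mi) by rewrite -NM mulKmx.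
move=> /matrixP/(_ l j); rewrite mxE => ->; rewrite mxE big1 // => k _.
by rewrite j0 mulr0.
Qed.

End MatrixIdentities.

Section ConnectionData.
Variable C : numFieldType.

Lemma near_invr_at (u : C) (P : C -> Prop) : u != 0 ->
  (\forall v \near u, P v) -> \forall x \near u^-1, P x^-1.
Proof.
move=> u0 Pu; have cV : x^-1 @[x --> u^-1] --> u^-1^-1.
  by apply: (@cvgV _ _ (nbhs u^-1)); [rewrite invr_eq0|exact: cvg_id].
by move: cV; rewrite invrK; apply.
Qed.

Lemma solution_at_0_data q n (A : 'M[{poly C}]_n) rho P M0 : solution_at_0 q A rho P M0 ->
  [/\ forall z, meromorphic_mx M0 z, \forall x \near (0 : C)^', M0 x \in unitmx &
      \forall x \near (0 : C)^', M0 (q * x) *m diag_mx rho = mx_horner A x *m M0 x].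
Proof.
case=> MG _ MA Mm; have Mu := GL_pseries_unit MG; split => //.
  exact: near_dnbhs_near.
apply: near_dnbhs_near; move: MA Mu; apply: filterS2 => x MA Mu.
have -> : mx_horner A x = mx_eval A x by apply/matrixP => i j; rewrite !mxE.
by rewrite -MA /gauge_fun mulmxKV.
Qed.

Lemma solution_at_infty_data q n mu (A : 'M[{poly C}]_n) sigma Q Minf :
    solution_at_infty q mu A sigma Q Minf ->
  [/\ forall z, z != 0 -> meromorphic_mx Minf z, meromorphic_mx (fun u => Minf u^-1) 0,
      \forall u \near (0 : C)^', Minf u^-1 \in unitmx &
      \forall u \near (0 : C)^', Minf (q * u^-1) *m (u^-1 ^+ mu *: diag_mx sigma)
        = mx_horner A u^-1 *m Minf u^-1].
Proof.
case=> -[U [UG _ MU]] MA Mm.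
have Mu : \forall u \near (0 : C)^', Minf u^-1 \in unitmx.
  by move: MU (near_dnbhs_near (GL_pseries_unit UG)); apply: filterS2 => u ->.
split => //.
  apply: meromorphic_mx_ext (mx_pseries_meromorphic UG.1).
  by move: MU; apply: filterS => u ->.
move: MA Mu; apply: filterS2 => u MA Mu.
have -> : mx_horner A u^-1 = mx_eval A u^-1 by apply/matrixP => i j; rewrite !mxE.
by rewrite -MA /gauge_fun mulmxKV.
Qed.

End ConnectionData.

Section ConnectionMatrix.
Local Open Scope complex_scope.
Variable R : realType.
Local Notation C := (R[i] : numFieldType).
Let cvg_half := @cvg_half_complex R.
Local Notation qshift q := (fun p : {poly C} => p \Po (q *: 'X)).

Variables (q : C) (n mu : nat) (A : 'M[{poly C}]_n).
Variables (rho sigma : 'rV[C]_n) (M M0 Minf : C -> 'M[C]_n).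
Hypothesis q0 : q != 0.
Hypothesis M0m : forall z, meromorphic_mx M0 z.
Hypothesis M0u : \forall x \near (0 : C)^', M0 x \in unitmx.
Hypothesis M0A : \forall x \near (0 : C)^',
  M0 (q * x) *m diag_mx rho = mx_horner A x *m M0 x.
Hypothesis Mim : forall z, z != 0 -> meromorphic_mx Minf z.
Hypothesis Mim0 : meromorphic_mx (fun u => Minf u^-1) 0.
Hypothesis Miu : \forall u \near (0 : C)^', Minf u^-1 \in unitmx.
Hypothesis MiA : \forall u \near (0 : C)^',
  Minf (q * u^-1) *m (u^-1 ^+ mu *: diag_mx sigma) = mx_horner A u^-1 *m Minf u^-1.
Hypothesis Mh : mx_holomorphic_on [set z : C | z != 0] M.
Hypothesis ME : forall z : C, z != 0 ->
  \forall x \near z^', M x = invmx (M0 x) *m Minf x.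

(** The subspace selects the rows [a] through the basis at 0 and the columns [b] through the basis
    at infinity. Holomorphy of [M] turns the vanishing near each nonzero point into vanishing at
    it. *)
Lemma lattice_zero_block : invariant_lattice (qshift q) A ->
    (forall j, rho 0 j != 0) ->
    (forall i j, i != j -> ~ congruent_mod_qZ q (rho 0 i) (rho 0 j)) ->
    (forall j, sigma 0 j != 0) ->
    (forall i j, i != j -> ~ congruent_mod_qZ q (sigma 0 i) (sigma 0 j)) ->
  exists m (a b : 'I_m -> 'I_n), [/\ (0 < m < n)%N, injective a, injective b &
    forall l j, j \notin codom b -> forall x : C, x != 0 -> M x (a l) j = 0].
Proof.
move=> [m [f [e [P [B [mn e0 Pf EP]]]]]] rho0 rhoq sigma0 sigmaq.
have Pfree z : \forall x \near z^', row_free (mx_horner P x).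
  move: (near_horner_neq0 z Pf); apply: filterS => x Px.
  apply: (@colsub_unit_free _ _ _ _ f); rewrite unitmx_det; move: Px.
  by rewrite -/(horner_eval x _) -det_map_mx map_mxsub.
have [a ai a0] := lattice_columns_at_0 q0 e0 Pfree EP rho0 rhoq M0m M0u M0A.
have [b bi b0] := lattice_columns_at_infty q0 e0 Pf EP sigma0 sigmaq Mim Mim0 Miu MiA.
exists m, a, b; split => // l j jb z z0.
apply: (@holomorphic_near0 C (fun x => M x (a l) j) z); first exact: Mh.
have a0' : \forall x \near z^', forall k i, i \notin codom a ->
    (mx_horner P x *m M0 x) k i = 0.
  apply: filter_forall => k; apply: filter_forall => i.
  have [ia|ia] := boolP (i \in codom a); first by near=> x.
  by move: (a0 k i ia z); apply: filterS => x ->.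
have b0' : \forall x \near z^', forall k, (mx_horner P x *m Minf x) k j = 0.
  by apply: filter_forall => k; exact: b0.
have M0uz : \forall x \near z^', M0 x \in unitmx by exact: near_unit M0m M0u.
have ab0 := near_dnbhsI a0' b0'; have PM0 := near_dnbhsI (Pfree z) M0uz.
have MEz := ME z0; move: ab0 PM0 MEz; apply: filterS3 => x [a0x b0x] [Px M0x] MEx.
by rewrite MEx; exact: zero_entries ai Px M0x a0x b0x l.
Unshelve. all: by end_near. Qed.

(* By M0^-1 = M Minf^-1 the rows [a] of M0^-1 and the rows [b] of Minf^-1 span the
   same subspace wherever both make sense. Its normalized basis [L0 = Li] is
   meromorphic on the whole sphere, hence rational. *)
Lemma zero_block_lattice m (a b : 'I_m -> 'I_n) : (0 < m < n)%N -> injective a ->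
    injective b ->
    (forall l j, j \notin codom b -> forall x : C, x != 0 -> M x (a l) j = 0) ->
  invariant_lattice (qshift q) A.
Proof.
move=> mn ai bi Mab.
pose Y0 x := rowsub a (invmx (M0 x)); pose Yi x := rowsub b (invmx (Minf x)).
have M0uz z : \forall x \near z^', M0 x \in unitmx by exact: near_unit M0m M0u.
have Miuz z (z0 : z != 0) : \forall x \near z^', Minf x \in unitmx.
  exact: near_unit_infty Mim Miu z0.
have Y0m z : meromorphic_mx Y0 z.
  by apply: meromorphic_mx_sub; exact: (meromorphic_mxV cvg_half).
have Y0free : \forall x \near (0 : C)^', row_free (Y0 x).
  by move: M0u; apply: filterS => x Mx; apply: row_free_rowsub => //; rewrite unitmx_inv.
(* One minor, chosen near 0, serves everywhere: its determinant is meromorphic on the plane, so it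
   is generically nonzero near every point. *)
have [f Y0f] := generic_minor cvg_half (Y0m 0) Y0free.
have Y0fm z : meromorphic_mx (fun x => colsub f (Y0 x)) z by exact: meromorphic_mx_sub.
have Y0fu z : \forall x \near z^', colsub f (Y0 x) \in unitmx by exact: near_unit Y0fm Y0f.
pose L0 x := invmx (colsub f (Y0 x)) *m Y0 x; pose Li x := invmx (colsub f (Yi x)) *m Yi x.
have L0m z : meromorphic_mx L0 z.
  by apply: (meromorphic_mxM cvg_half) => //; exact: (meromorphic_mxV cvg_half).
have Lim : meromorphic_mx (fun u => Li u^-1) 0.
  have Yim : meromorphic_mx (fun u => Yi u^-1) 0.
    by apply: meromorphic_mx_sub; exact: (meromorphic_mxV cvg_half).
  apply: (meromorphic_mxM cvg_half) => //; apply: (meromorphic_mxV cvg_half).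
  exact: meromorphic_mx_sub.
(* The rows [a] of [M] vanish off the columns [b], so [M0^-1 = M Minf^-1] gives
   [Y0 = mxsub a b M *m Yi]. *)
have L0i z (z0 : z != 0) : \forall x \near z^', L0 x = Li x.
  have MEz := ME z0; have MYz := near_dnbhsI (Miuz z z0) (Y0fu z).
  move: MEz MYz (near_neq0 z).
  apply: filterS3 => x MEx [Mix Yx] x0; apply: (@minor_normalization _ _ _ f (mxsub a b (M x))) => //.
  rewrite /Y0 /Yi -[invmx (M0 x)](mulmxK Mix) -MEx -mul_rowsub_mx.
  rewrite -(colsub_rowsub_mul _ bi); first by rewrite -mxsub_comp.
  by move=> k i ib; rewrite mxE; exact: Mab.
have rat (kj : 'I_m * 'I_n) : exists d p : {poly C}, d != 0 /\
    forall z, \forall x \near z^', d.[x] * L0 x kj.1 kj.2 = p.[x].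
  (* Away from 0 the entry of [L0] is that of [Li], whose pole in [u] at 0 bounds the growth at
     infinity by [x ^ N]. *)
  have [N [g [gs gE]]] := Lim kj.1 kj.2.
  apply: (@meromorphic_sphere_rational R N _ g) => //; first by move=> z; exact: L0m.
  have := near_dnbhs_near (near_near gE); move: (near_neq0 (0 : C)).
  apply: filterS2 => u u0 /(_ u0) /(near_invr_at u0)/near_dnbhs_near gu.
  move: gu (near_neq0 u^-1) (L0i u^-1 (invr_neq0 u0)).
  apply: filterS3 => x; rewrite add0r invrK => <- x0 ->.
  by rewrite mulrA -exprMn mulfV // expr1n mul1r.
have /choice[d /choice[p dp]] := rat.
pose D : {poly C} := \prod_kj d kj.
have D0 : D != 0 by apply/prodf_neq0 => kj _; case: (dp kj).
pose P : 'M[{poly C}]_(m, n) :=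
  \matrix_(k, j) (p (k, j) * \prod_(kj | kj != (k, j)) d kj).
have PE z : \forall x \near z^', mx_horner P x = D.[x] *: L0 x.
  have : \forall x \near z^', forall kj, (d kj).[x] * L0 x kj.1 kj.2 = (p kj).[x].
    by apply: filter_forall => kj; case: (dp kj).
  have DE kj : D = d kj * \prod_(i | i != kj) d i by rewrite /D (bigD1 kj).
  apply: filterS => x dpx; apply/matrixP => k j; rewrite mx_hornerE [P k j]mxE [RHS]mxE.
  by rewrite hornerM -(dpx (k, j)) (DE (k, j)) hornerM mulrAC.
have fP : colsub f P = D%:M.
  apply: (@near_mx_horner_eq _ _ _ _ _ 0); move: (PE 0) Y0f; apply: filterS2 => x Px Yx.
  rewrite mx_horner_colsub Px [RHS]map_scalar_mx.
  have := colsub_normalization Yx; rewrite -/(L0 x) => Lx.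
  by rewrite colsub_scale Lx scalemx1.
(* As [P = D L0] and [L0] is the identity on the columns [f], stability gives [P(qx) A = B L0] with
   [B] the columns [f] of the left side; multiplying by [D] replaces [L0] by [P]. *)
exists m, f, D, P, (colsub f (map_mx (qshift q) P *m A)); split => //.
  by rewrite fP det_scalar expf_neq0.
apply: (@near_mx_horner_eq _ _ _ _ _ 0).
have PEq := near_dnbhs0_scale q0 (PE 0).
have M0uq := near_dnbhs0_scale q0 M0u; have Y0fq := near_dnbhs0_scale q0 Y0f.
have PP := near_dnbhsI (PE 0) PEq; have YY := near_dnbhsI Y0f Y0fq.
have MM := near_dnbhsI M0A (near_dnbhsI M0u M0uq); move: PP YY MM.
apply: filterS3 => x [Px Pqx] [Yx Yqx] [MAx [M0x M0qx]].
have LA : L0 (q * x) *m mx_horner A x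
    = colsub f (L0 (q * x) *m mx_horner A x) *m L0 x.
  exact: normalized_rows_shift M0x M0qx MAx Yx Yqx.
rewrite mx_hornerZ !mx_hornerM mx_horner_colsub mx_hornerM mx_horner_qshift Px Pqx.
by rewrite -!scalemxAl colsub_scale -scalemxAl -scalemxAr {1}LA !scalerA mulrC.
Qed.

End ConnectionMatrix.

(** Both orientations give the same shape: the last [n - r] indices serve as [a] and [b] when the
    lower left block vanishes, the first [r] indices when the upper right one does. *)
Lemma block_triangular_zero_block n (Z : 'I_n -> 'I_n -> Prop) : block_triangular Z ->
  exists m (a b : 'I_m -> 'I_n), [/\ (0 < m < n)%N, injective a, injective b &
    forall l j, j \notin codom b -> Z (a l) j].
Proof.
move=> [r /andP[r0 rn] H].
have [k nE] : exists k, n = (r + k)%N by exists (n - r)%N; rewrite subnKC // ltnW.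
subst n; case: H => H.
  exists k, (@rshift r k), (@rshift r k); split; try exact: rshift_inj.
    by rewrite -{2}(add0n k) ltn_add2r r0 andbT -(ltn_add2l r) addn0.
  move=> l j; case: (split_ordP j) => j' -> jc; last by rewrite codom_f in jc.
  by apply: H => /=; rewrite ?leq_addr.
exists r, (@lshift r k), (@lshift r k); split; try exact: lshift_inj.
  by rewrite r0.
move=> l j; case: (split_ordP j) => j' -> jc; first by rewrite codom_f in jc.
by apply: H => /=; rewrite ?leq_addr.
Qed.

Theorem theorem3p10 (R : realType) (q : R[i]) (n mu : nat)
    (A : 'M[{poly R[i]}]_n) (rho sigma : 'rV[R[i]]_n)
    (M : R[i] -> 'M[R[i]]_n)
    (q_gt0 : 0 < `|q|) (q_lt1 : `|q| < 1) (n_ge1 : (1 <= n)%N)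
    (degA : forall i j : 'I_n, (size (A i j) <= mu.+1)%N)
    (A0_unit : mx_coef A 0 \in unitmx)
    (Amu_unit : mx_coef A mu \in unitmx)
    (rho_spec : noncongruent_spectrum q (mx_coef A 0) rho)
    (sigma_spec : noncongruent_spectrum q (mx_coef A mu) sigma)
    (connM : connection_matrix q mu A rho sigma M) :
  reducible q A <->
  exists s t : 'S_n,
    block_triangular
      (fun i j => forall x : R[i], x != 0 ->
         row_perm s (col_perm t (M x)) i j = 0).
Proof.
have q0 : q != 0 by rewrite -normr_gt0.
case: connM => P [Q [M0 [Minf [[_ A0E] [_ AmuE] S0 Sinf [Mh ME]]]]].
have rho0 : forall j, rho 0 j != 0.
  by move: A0_unit; rewrite A0E; exact: conj_diag_unit.
have sigma0 : forall j, sigma 0 j != 0.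
  by move: Amu_unit; rewrite AmuE; exact: conj_diag_unit.
have [M0m M0u M0A] := solution_at_0_data S0.
have [Mim Mim0 Miu MiA] := solution_at_infty_data Sinf.
split.
  move=> /(reducibleP q0) lat.
  have [m [a [b [mn ai bi ab0]]]] := lattice_zero_block q0 M0m M0u M0A Mim Mim0 Miu MiA
    Mh ME lat rho0 rho_spec.2 sigma0 sigma_spec.2.
  have [s sE] := extend_inj_perm ai; have [t tE] := extend_inj_perm bi.
  (* The rows [a] and the columns [b] are moved to the first [m] places, so the zero block becomes
     the upper right one; a column of index at least [m] comes from outside the image of [b]. *)
  exists s, t, m => //; right=> i j im mj x x0.
  rewrite !mxE (sE (Ordinal im)) //; apply: ab0 => //.
  apply: contraL mj => /codomP[l tj]; rewrite -ltnNge.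
  have ln : (l < n)%N by apply: leq_trans (ltn_ord l) _; case/andP: mn => _ /ltnW.
  have jE : j = Ordinal ln by apply: (@perm_inj _ t); rewrite tj (tE l).
  by rewrite jE; exact: (ltn_ord l).
move=> [s [t /block_triangular_zero_block[m [a [b [mn ai bi ab0]]]]]].
apply/(reducibleP q0).
apply: (zero_block_lattice (a := s \o a) (b := t \o b) q0 M0m M0u M0A Mim Mim0 Miu ME mn).
- exact: inj_comp perm_inj ai.
- exact: inj_comp perm_inj bi.
move=> l j jb x x0; have := ab0 l ((t^-1)%g j) _ x x0; rewrite !mxE permKV; apply.
by apply: contra jb => /codomP[k kE]; apply/codomP; exists k; rewrite /= -kE permKV.
Qed.
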